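(* Let $R=K[x_0,\dots,x_n]$ with $K$ an infinite field, and let $I\subset R$ be a homogeneous ideal whose codimension is at least two. Then there is a finite sequence of basic double links, starting from $I$, that results in an ideal that is numerically ACM.
   Context: Basic double link: given a nonzero homogeneous ideal $I\subset R$, a nonzero homogeneous form $F\in I$ of degree $d$, and a general form $G\in R$ of degree $a$, the ideal $J=G\cdot I+(F)$ is called a basic double link of $I$ of type $(d,a)$ (no unmixedness of $I$ is required). A sequence of basic double links starting from $I$ is a sequence of ideals $I=I_0,I_1,\dots,I_t$ in which each $I_j$ is a basic double link of $I_{j-1}$. Numerically ACM: a subscheme $X\subset\mathbb P^n$ is ACM (arithmetically Cohen-Macaulay) if $R/I_X$ is Cohen-Macaulay, where $I_X$ is its saturated ideal. A homogeneous ideal $J\subset R$ is numerically ACM if $R/J$ has the same Hilbert function as $R/I_Y$ for some codimension two ACM subscheme $Y\subset\mathbb P^n$.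
   Formalization: The formal theorem assumes n ≥ 2; for n ≤ 1 there is no codimension two subscheme of P^n, and the claim fails, for example for I = (x_0, x_1) in K[x_0, x_1]. *)

(* Defs.v *)
From HB Require Import structures.
From mathcomp Require Import all_boot all_order all_algebra.
From mathcomp Require Import mpoly.

Set Implicit Arguments.
Unset Strict Implicit.
Unset Printing Implicit Defensive.

Import GRing.Theory.
Local Open Scope ring_scope.

(* Ideals are Prop-valued, as membership in a set of ring elements need not be
   decidable. *)
Section CommutativeAlgebra.
Context {R : comNzRingType}.
Implicit Types (I J P M : R -> Prop) (f g h : R).

Definition subideal I J : Prop := forall f, I f -> J f.

Definition is_ideal I : Prop :=
  [/\ I 0,
      forall f g, I f -> I g -> I (f + g) &
      forall f g, I g -> I (f * g)].

Definition is_prime P : Prop :=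
  [/\ is_ideal P, ~ P 1 & forall f g, P (f * g) -> P f \/ P g].

Definition is_maximal M : Prop :=
  [/\ is_ideal M, ~ M 1 &
      forall J, is_ideal J -> subideal M J -> ~ J 1 -> subideal J M].

Definition zero_ideal f : Prop := f = 0.

(* The ideal I + (f). *)
Definition add_gen I f : R -> Prop :=
  fun g => exists2 u, I u & exists h, g = u + h * f.

(* A chain Q_0 < ... < Q_k = P of primes containing I, that is, a chain of
   length k of primes of R/I descending from P/I: the height of P/I in R/I is
   at least k. *)
Definition height_ge I P (k : nat) : Prop :=
  exists Q : nat -> R -> Prop,
    [/\ forall i, (i <= k)%N -> is_prime (Q i),
        subideal I (Q 0%N),
        forall i, (i < k)%N ->
          subideal (Q i) (Q i.+1) /\ ~ subideal (Q i.+1) (Q i) &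
        forall f, Q k f <-> P f].

(* The codimension of I is the least height of a prime containing I; the unit
   ideal has infinite codimension. *)
Definition codim_ge I (c : nat) : Prop :=
  forall P, is_prime P -> subideal I P -> height_ge zero_ideal P c.

Definition codim_eq I (c : nat) : Prop := codim_ge I c /\ ~ codim_ge I c.+1.

(* s is a regular sequence on R/I. *)
Fixpoint regular_seq I (s : seq R) : Prop :=
  if s is f :: s' then
    (forall g, I (f * g) -> I g) /\ regular_seq (add_gen I f) s'
  else ~ I 1.

Definition depth_ge I P (k : nat) : Prop :=
  exists s : seq R,
    [/\ size s = k, forall f, f \in s -> P f & regular_seq I s].

(* R/I is Cohen-Macaulay: the depth (grade) of every maximal ideal of R/I is
   equal to its height. For Noetherian rings this agrees with the condition on
   localizations, as the grade of a maximal ideal is the depth of the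
   localization at it. *)
Definition cohen_macaulay_quotient I : Prop :=
  forall M, is_maximal M -> subideal I M ->
    forall k, depth_ge I M k <-> height_ge I M k.

End CommutativeAlgebra.

Section Graded.
Context {K : fieldType} {n : nat}.
Local Notation R := {mpoly K[n.+1]}.
Implicit Types (I J : R -> Prop).

Definition homogeneous_ideal I : Prop :=
  is_ideal I /\ forall d f, I f -> I (pihomog mdeg d f).

(* The ideals of closed subschemes of P^n: f * m^k is contained in I only if f
   is in I, where m is the irrelevant ideal. *)
Definition saturated I : Prop :=
  forall f, (exists k, forall g : dhomog n.+1 K k, I (f * val g)) -> I f.

(* The Hilbert function of R/J takes the value k at t. *)
Definition hilbert_value J (t k : nat) : Prop :=
  exists2 V : {vspace dhomog n.+1 K t},
    forall f : dhomog n.+1 K t, f \in V <-> J (val f) &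
    (\dim V + k)%N = \dim {:dhomog n.+1 K t}.

Definition same_hilbert_function I J : Prop :=
  forall t, exists2 k, hilbert_value I t k & hilbert_value J t k.

(* A subscheme of P^n is given by its saturated homogeneous ideal. *)
Definition ACM_codim2 I : Prop :=
  [/\ homogeneous_ideal I, saturated I, codim_eq I 2 & cohen_macaulay_quotient I].

Definition numerically_ACM J : Prop :=
  homogeneous_ideal J /\
  exists2 IY : R -> Prop, ACM_codim2 IY & same_hilbert_function J IY.

(* The forms of degree a are the points of an affine space, with coordinates
   given by a basis. A property holds for the general form of degree a if it
   holds on a nonempty Zariski-open subset of that space; it is enough to
   consider principal open subsets. *)
Definition general_form (a : nat) (prop : dhomog n.+1 K a -> Prop) : Prop :=
  exists2 Phi : {mpoly K[\dim {:dhomog n.+1 K a}]}, Phi != 0 &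
    forall G : dhomog n.+1 K a,
      Phi.@[fun i => coord (vbasis {:dhomog n.+1 K a}) i G] != 0 -> prop G.

(* The ideal G * I + (F). *)
Definition double_link I (F G : R) : R -> Prop :=
  fun f => exists2 u, I u & exists h, f = G * u + h * F.

(* Some sequence of basic double links of the types (d_1,a_1), ..., (d_t,a_t)
   starting from I ends in an ideal satisfying prop: there is a nonzero form F_1
   of degree d_1 in I such that for general G_1 of degree a_1, there is a nonzero
   form F_2 of degree d_2 in I_1 = G_1 I + (F_1) such that for general G_2, and
   so on. Genericity of G_j is thus relative to the earlier choices. *)
Fixpoint basic_double_links (types : seq (nat * nat)) (prop : (R -> Prop) -> Prop)
    I : Prop :=
  if types is (d, a) :: types' then
    exists F : dhomog n.+1 K d,
      [/\ I (val F), F != 0 &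
          general_form (fun G : dhomog n.+1 K a =>
            basic_double_links types' prop (double_link I (val F) (val G)))]
  else prop I.

End Graded.

(* Main.v *)
(* If the Hilbert series of R/I is p(T) / (1 - T)^n, and F in I of degree d and
   the linear form G are coprime, then that of G I + (F) is
   (T p + 1 - T^d) / (1 - T)^n. After t links with degrees d_j = j + s_j the
   numerator is T^t p + (1 + .. + T^(t-1)) - T^t (T^(s_1) + .. + T^(s_t)).

   If I has codimension at least two, then p = (1 - T) k with a polynomial k,
   whence p is the sum of the T^a, a in A, minus the sum of the T^b, b in B, for
   lists A and B of the same length. So the links starting from I with
   s = D-1, .., 1, 0, A and those starting from the unit ideal with
   s = D-1, .., 1, 0, B (A and B sorted, D large) end in the same Hilbert
   function. The latter links can be taken with F a power of x_1 and G = x_0;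
   they end in the extension to R of an Artinian monomial ideal of K[x_0, x_1],
   which defines an ACM subscheme of codimension two.

   The dimension theory rests on the growth of the dimension of the space of
   polynomials of degree at most t modulo an ideal: enlarging an ideal by a
   regular element lowers the exponent of growth by one. *)

Require Import Defs.
From Stdlib Require Import Classical ClassicalEpsilon.
From HB Require Import structures.
From mathcomp Require Import all_boot all_order all_algebra.
From mathcomp Require Import mpoly.
From mathcomp Require Import zify ring.

Set Implicit Arguments.
Unset Strict Implicit.
Unset Printing Implicit Defensive.

Import Order.TTheory GRing.Theory.
Local Open Scope ring_scope.

Section Ideals.
Context {R : comNzRingType}.
Implicit Types (I J M P : R -> Prop) (f g h : R).

Definition colon I f : R -> Prop := fun g => I (f * g).

Section Closure.
Variables (I : R -> Prop) (idI : is_ideal I).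

Lemma ideal_zero : I 0. Proof. by case: idI. Qed.

Lemma ideal_add f g : I f -> I g -> I (f + g).
Proof. by case: idI => _ + _; apply. Qed.

Lemma ideal_mull f g : I g -> I (f * g).
Proof. by case: idI => _ _; apply. Qed.

Lemma ideal_mulr f g : I f -> I (f * g).
Proof. by rewrite mulrC; apply: ideal_mull. Qed.

Lemma ideal_opp f : I f -> I (- f).
Proof. by move=> If; rewrite -mulN1r; apply: ideal_mull. Qed.

Lemma ideal_sub f g : I f -> I g -> I (f - g).
Proof. by move=> If Ig; apply: ideal_add => //; apply: ideal_opp. Qed.

Lemma ideal_sum (T : Type) (s : seq T) (p : pred T) (F : T -> R) :
  (forall i, p i -> I (F i)) -> I (\sum_(i <- s | p i) F i).
Proof. exact: (big_ind I ideal_zero ideal_add). Qed.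

Lemma ideal_subr f g : I (f - g) -> I g -> I f.
Proof. by move=> Ifg Ig; rewrite -(subrK g f); apply: ideal_add. Qed.

Lemma ideal_subl f g : I (f - g) -> I f -> I g.
Proof. by move=> Ifg If; rewrite -(subKr f g); apply: ideal_sub. Qed.

Lemma ideal1 f : I 1 -> I f.
Proof. by move=> I1; rewrite -[f]mulr1; apply: ideal_mull. Qed.

Lemma add_gen_ideal f : is_ideal (add_gen I f).
Proof.
split; first by exists 0; [exact: ideal_zero | exists 0; rewrite mul0r addr0].
- move=> _ _ [u Iu [h ->]] [v Iv [k ->]]; exists (u + v); first exact: ideal_add.
  by exists (h + k); rewrite mulrDl addrACA.
- move=> g _ [u Iu [h ->]]; exists (g * u); first exact: ideal_mull.
  by exists (g * h); rewrite mulrDr mulrA.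
Qed.

Lemma colon_ideal f : is_ideal (colon I f).
Proof.
split; rewrite /colon.
- by rewrite mulr0; apply: ideal_zero.
- by move=> g h; rewrite mulrDr; apply: ideal_add.
- by move=> g h; rewrite mulrCA; apply: ideal_mull.
Qed.

Lemma add_gen_sub f : subideal I (add_gen I f).
Proof. by move=> g Ig; exists g => //; exists 0; rewrite mul0r addr0. Qed.

Lemma add_gen_mem f : add_gen I f f.
Proof. by exists 0; [exact: ideal_zero | exists 1; rewrite mul1r add0r]. Qed.

Lemma colon_sub f : subideal I (colon I f).
Proof. by move=> g Ig; apply: ideal_mull. Qed.

Lemma add_gen_min J f : is_ideal J -> subideal I J -> J f -> subideal (add_gen I f) J.
Proof.
by move=> [_ JD JM] IJ Jf _ [u Iu [h ->]]; apply: JD; [apply: IJ | apply: JM].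
Qed.

End Closure.

Lemma not_subidealP I J : ~ subideal J I -> exists2 f, J f & ~ I f.
Proof.
move=> nJI; apply: NNPP => nof; apply: nJI => f Jf; apply: NNPP => If.
by apply: nof; exists f.
Qed.

Lemma prime_expr P f k : is_prime P -> P (f ^+ k) -> P f.
Proof.
move=> [_ P1 primeP]; elim: k => [|k IHk]; first by rewrite expr0.
by rewrite exprS => /primeP [].
Qed.

Lemma zero_idealP : is_ideal (@zero_ideal R).
Proof.
by split=> // [f g -> ->|f g ->]; rewrite /zero_ideal ?addr0 ?mulr0.
Qed.

Lemma maximal_inv M f : is_maximal M -> ~ M f -> exists g, M (1 - f * g).
Proof.
move=> [idM M1 maxM] Mf.
have /NNPP [u Mu [h e]] : ~ ~ add_gen M f 1.
  move=> M'1; apply: Mf; apply: (maxM _ (add_gen_ideal idM f)) => //.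
    exact: add_gen_sub.
  exact: add_gen_mem.
by exists h; rewrite e mulrC addrK.
Qed.

Lemma maximal_prime M : is_maximal M -> is_prime M.
Proof.
move=> maxM; have [idM M1 _] := maxM; split=> // f g Mfg.
have [|Mf] := classic (M f); [by left | right].
have [h Mh] := maximal_inv maxM Mf.
apply: (ideal_subr idM _ (ideal_mulr idM h Mfg)).
by rewrite (_ : g - f * g * h = g * (1 - f * h)); [apply: ideal_mull | ring].
Qed.

End Ideals.

(** * Dickson's lemma and Noetherian induction *)

Lemma nat_nondecreasing_subseq (u : nat -> nat) :
  exists2 s : nat -> nat, {homo s : i j / (i < j)%N} &
    {homo u \o s : i j / (i <= j)%N}.
Proof.
have minP (i : nat) : exists j, (i <= j)%N /\ forall k, (i <= k)%N -> (u j <= u k)%N.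
  have exP : exists v, exists2 j, (i <= j)%N & u j = v by exists (u i), i.
  have [v [[j ij uj] vmin]] :
      exists v, (exists2 j, (i <= j)%N & u j = v) /\
        forall k, (i <= k)%N -> (v <= u k)%N.
    case: exP => v; elim/ltn_ind: v => v IHv [j ij uj].
    have [[k [ik uk]]|noj] := classic (exists k, (i <= k)%N /\ (u k < v)%N).
      by apply: (IHv _ uk); exists k.
    exists v; split; first by exists j.
    by move=> k ik; rewrite leqNgt; apply/negP => uk; apply: noj; exists k.
  by exists j; rewrite uj.
have [m mP] := choice _ minP.
pose s := fix s k := if k is k'.+1 then m (s k').+1 else m 0%N.
have s_lt : {homo s : i j / (i < j)%N}.
  apply: (@homo_ltn _ s (fun i j => i < j)%N) => [? ? ?|i]; first exact: ltn_trans.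
  by case: (mP (s i).+1).
exists s => //.
apply: (@homo_leq _ (u \o s) (fun i j => i <= j)%N) => [//|? ? ?|i]; first exact: leq_trans.
case: i => [|i] /=; first by case: (mP 0%N) => _; apply.
case: (mP (s i).+1) => _; apply; rewrite -[m (s i).+1]/(s i.+1).
by case: (mP (s i.+1).+1) => + _; have := s_lt i i.+1 (ltnSn _); lia.
Qed.

Lemma dickson (m : nat) (u : nat -> 'X_{1..m}) :
  exists i j, (i < j)%N /\ (u i <= u j)%MM.
Proof.
suff [s s_lt s_le] : exists2 s : nat -> nat, {homo s : i j / (i < j)%N} &
    forall k : 'I_m, {homo (fun i => u (s i) k) : i j / (i <= j)%N}.
  exists (s 0%N), (s 1%N); split; first exact: s_lt.
  by apply/mnm_lepP => k; apply: s_le.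
suff /(_ m)[s s_lt s_le]: forall l, exists2 s : nat -> nat, {homo s : i j / (i < j)%N} &
    forall k : 'I_m, (k < l)%N -> {homo (fun i => u (s i) k) : i j / (i <= j)%N}.
  by exists s => // k; apply: s_le.
elim=> [|l [s s_lt s_le]]; first by exists id.
have [lm|ml] := ltnP l m; last first.
  by exists s => // k _; apply: s_le; apply: leq_trans (ltn_ord k) ml.
have [r r_lt r_le] := nat_nondecreasing_subseq (fun i => u (s i) (Ordinal lm)).
exists (s \o r) => [i j ij|k]; first exact/s_lt/r_lt.
rewrite ltnS leq_eqVlt => /orP[/eqP kl|kl].
  by have -> : k = Ordinal lm by exact/val_inj.
move=> i j; rewrite leq_eqVlt => /orP[/eqP-> //|ij].
by apply: s_le => //; apply/ltnW/r_lt.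
Qed.

Section LeadReduction.
Context {A : idomainType} {m : nat}.
Implicit Types f g : {mpoly A[m]}.

Definition lead_step f g : {mpoly A[m]} :=
  mleadc g *: f - mleadc f *: ('X_[mlead f - mlead g] * g).

Lemma lead_step_lt f g : f != 0 -> (mlead g <= mlead f)%MM -> lead_step f g != 0 ->
  (mlead (lead_step f g) < mlead f)%O.
Proof.
move=> f0 le_gf r0; rewrite lt_neqAle; apply/andP; split.
  apply/negP => /eqP lead_eq; move: (r0); rewrite -mleadc_eq0 lead_eq => /negP[].
  have coefE : ('X_[mlead f - mlead g] * g)@_(mlead f) = mleadc g.
    by rewrite mulrC -[X in _@_X](submK le_gf) mcoeffMX.
  by rewrite mcoeffB !mcoeffZ coefE mulrC subrr.
rewrite (le_trans (mleadB_le _ _)) // leUx; apply/andP; split.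
  apply: le_trans (_ : mlead f <= _)%O => //.
  have [->|?] := eqVneq (mleadc g) 0; first by rewrite scale0r mlead0 le0m.
  by rewrite mleadZ.
have [->|?] := eqVneq (mleadc f) 0; first by rewrite scale0r mlead0 le0m.
rewrite mleadZ //; apply: le_trans (mleadM_le _ _) _.
by rewrite mleadXm submK.
Qed.

End LeadReduction.

Lemma noetherian_ind (K : fieldType) (m : nat) (Phi : ({mpoly K[m]} -> Prop) -> Prop) :
  (forall I, is_ideal I ->
     (forall J, is_ideal J -> subideal I J -> ~ subideal J I -> Phi J) -> Phi I) ->
  forall I, is_ideal I -> Phi I.
Proof.
move=> step I0 idI0; apply: NNPP => nPhi0.
pose bad := {I : {mpoly K[m]} -> Prop | is_ideal I /\ ~ Phi I}.
have nextP (I : bad) : exists J : bad,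
    subideal (sval I) (sval J) /\ ~ subideal (sval J) (sval I).
  case: I => I [idI nPhi] /=; apply: NNPP => noJ; apply: nPhi; apply: step => // J idJ IJ JI.
  by apply: NNPP => nPhiJ; apply: noJ; exists (exist _ J (conj idJ nPhiJ)).
have [next nextE] := choice _ nextP.
pose F k := iter k next (exist _ I0 (conj idI0 nPhi0)).
have idF k : is_ideal (sval (F k)) by case: (svalP (F k)).
have F_mono i j : (i <= j)%N -> subideal (sval (F i)) (sval (F j)).
  elim: j => [|j IHj]; first by rewrite leqn0 => /eqP->.
  rewrite leq_eqVlt => /orP[/eqP-> //|]; rewrite ltnS => /IHj ij f /ij.
  by case: (nextE (F j)) => + _; apply.
have minP k : exists g : {mpoly K[m]},
    [/\ sval (F k.+1) g, ~ sval (F k) g &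
        forall f, sval (F k.+1) f -> (mlead f < mlead g)%O -> sval (F k) f].
  have [_ /not_subidealP[f0 f0F f0N]] := nextE (F k).
  have: exists a, exists f, [/\ sval (F k.+1) f, ~ sval (F k) f & mlead f = a].
    by exists (mlead f0), f0.
  case=> a; elim/(well_founded_ind (@ltom_wf m)): a => a IHa [f [fF fN fa]].
  have [[g [gF [lt_gf gN]]]|nog] := classic (exists g, sval (F k.+1) g /\
      (mlead g < mlead f)%O /\ ~ sval (F k) g).
    by apply: (IHa (mlead g)); [rewrite -fa | exists g].
  exists f; split=> // g gF lt_gf; apply: NNPP => gN.
  by apply: nog; exists g.
have [g gP] := choice _ minP.
have [i [j [ij le_ij]]] := dickson (fun k => mlead (g k)).
have [gjF gjN gj_min] := gP j; have [giF _ _] := gP i.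
have gi_j : sval (F j) (g i) by apply: (F_mono i.+1).
have g0 k : g k != 0.
  by apply/eqP => gk0; case: (gP k) => _ + _; rewrite gk0; case; apply: ideal_zero.
have rF : sval (F j) (lead_step (g j) (g i)).
  have stepF : sval (F j.+1) (lead_step (g j) (g i)).
    rewrite /lead_step -!mul_mpolyC; apply: (ideal_sub (idF _)).
      exact: (ideal_mull (idF _)).
    by do 2!apply: (ideal_mull (idF _)); apply: (F_mono j).
  have [->|r0] := eqVneq (lead_step (g j) (g i)) 0; first exact: ideal_zero.
  by apply: gj_min => //; apply: lead_step_lt.
case: gjN; have c0 : mleadc (g i) != 0 by rewrite mleadc_eq0.
rewrite -[g j](scalerK c0) -mul_mpolyC; apply: (ideal_mull (idF _)).
apply: (ideal_subr (idF j) rF); rewrite -mul_mpolyC.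
by do 2!apply: (ideal_mull (idF _)).
Qed.

(* A finite set of leading monomials dominates all of them, so some power of the
   product s of their coefficients times f reduces modulo M to a polynomial
   without leading monomials of M in its support. *)
Lemma divides_power_of_generic (A : idomainType) (m : nat) (M : {mpoly A[m]} -> Prop) :
  is_ideal M -> (forall a, M a%:MP -> a = 0) ->
  (forall a, a != 0 -> exists g, M (1 - a%:MP * g)) ->
  exists2 s : A, s != 0 & forall a, a != 0 -> exists N b, s ^+ N = a * b.
Proof.
move=> idM MA Minv.
have [fs fsM fs_dom] : exists2 fs : seq {mpoly A[m]},
    forall f, f \in fs -> M f /\ f != 0 &
    forall f, M f -> f != 0 -> exists2 g, g \in fs & (mlead g <= mlead f)%MM.
  apply: NNPP => nofs.
  have nextP (l : seq {mpoly A[m]}) : exists f, (forall g, g \in l -> M g /\ g != 0) ->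
      [/\ M f, f != 0 & forall g, g \in l -> ~~ (mlead g <= mlead f)%MM].
    have [lM|] := classic (forall g, g \in l -> M g /\ g != 0); last by exists 0.
    apply: NNPP => nof; apply: nofs; exists l => // f Mf f0; apply: NNPP => nog.
    apply: nof; exists f => _; split=> // g gl; apply/negP => le_gf.
    by apply: nog; exists g.
  have [next nextE] := choice _ nextP.
  pose l k := iter k (fun l => next l :: l) [::].
  have lM k : forall g, g \in l k -> M g /\ g != 0.
    elim: k => [//|k IHk] g; rewrite inE => /orP[/eqP->|]; last exact: IHk.
    by case: (nextE _ IHk).
  have l_mem i j : (i < j)%N -> next (l i) \in l j.
    elim: j => [//|j IHj]; rewrite ltnS leq_eqVlt inE => /orP[/eqP->|/IHj->].
      by rewrite eqxx.
    by rewrite orbT.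
  have [i [j [ij le_ij]]] := dickson (fun k => mlead (next (l k))).
  by have [_ _ /(_ _ (l_mem _ _ ij))/negP[]] := nextE _ (lM j).
pose s := \prod_(g <- fs) mleadc g.
have s0 : s != 0.
  rewrite prodf_seq_neq0; apply/allP => g /fsM[_ g0].
  by rewrite mleadc_eq0.
pose lead a := exists f, [/\ M f, f != 0 & mlead f = a].
have reduce f : exists N r, M (s ^+ N *: f - r) /\ forall a, a \in msupp r -> ~ lead a.
  have [a] : exists a, mlead f = a by exists (mlead f).
  elim/(well_founded_ind (@ltom_wf m)): a f => a IHa f fa.
  have [->|f0] := eqVneq f 0.
    by exists 0%N, 0; rewrite scaler0 subr0 msupp0; split=> //; apply: ideal_zero.
  have [[g [Mg g0 ga]]|nlead] := classic (lead a).
    have [q q_fs le_qg] := fs_dom _ Mg g0; have [Mq q0] := fsM _ q_fs.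
    have sE : s = \prod_(p <- rem q fs) mleadc p * mleadc q.
      by rewrite /s (big_rem q) //= mulrC.
    set u := \prod_(_ <- _) _ in sE.
    have red_r r N : M (s ^+ N *: (u *: lead_step f q) - r) ->
        M (s ^+ N.+1 *: f - r).
      move=> Mr; have sfE : s *: f = u *: (mleadc q *: f) by rewrite sE scalerA.
      rewrite exprSr -scalerA sfE.
      apply: (ideal_subr idM (g := s ^+ N *: (u *: (mleadc f *: ('X_[mlead f - mlead q] * q))))).
        by rewrite addrAC -!scalerBr.
      by rewrite -!mul_mpolyC; do 4!apply: (ideal_mull idM).
    have [r0|r0] := eqVneq (lead_step f q) 0.
      exists 1%N, 0; split; last by rewrite msupp0.
      by apply: red_r; rewrite r0 !scaler0 subr0; apply: ideal_zero.
    have u0 : u != 0 by move: s0; rewrite sE mulf_eq0 negb_or => /andP[].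
    have /IHa/(_ (u *: lead_step f q)) : (mlead (lead_step f q) < a)%O.
      by rewrite -fa lead_step_lt // fa -ga.
    by rewrite mleadZ // => /(_ erefl)[N [r [Mr red]]]; exists N.+1, r; split=> //; apply: red_r.
  pose f' := f - mleadc f *: 'X_[a].
  have f'lt : f' != 0 -> (mlead f' < a)%O.
    move=> f'0; rewrite lt_neqAle; apply/andP; split.
      apply/negP => /eqP lead_eq; move: (f'0); rewrite -mleadc_eq0 lead_eq => /negP[].
      by rewrite mcoeffB mcoeffZ mcoeffX eqxx mulr1 -fa subrr.
    rewrite (le_trans (mleadB_le _ _)) // leUx fa lexx /=.
    by rewrite mleadZ ?mleadXm // -fa mleadc_eq0.
  have [N [r [Mr red]]] : exists N r, M (s ^+ N *: f' - r) /\ forall a, a \in msupp r -> ~ lead a.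
    have [f'0|f'0] := eqVneq f' 0.
      exists 0%N, 0; rewrite f'0 scaler0 subr0 msupp0.
      by split=> //; apply: ideal_zero.
    by apply: IHa (f'lt f'0) _ erefl.
  exists N, (r + s ^+ N *: (mleadc f *: 'X_[a])); split.
    by move: Mr; rewrite /f' scalerBr opprD addrA addrAC.
  move=> b /msuppD_le; rewrite mem_cat => /orP[/red //|].
  by move=> /msuppZ_le /msuppZ_le; rewrite msuppX inE => /eqP->.
exists s => // a a0; have [g Mg] := Minv a a0; have [N [r [Mr red]]] := reduce g.
exists N, r@_0%MM; pose q := (s ^+ N)%:MP - a%:MP * r.
have Mq : M q.
  have -> : q = (s ^+ N)%:MP * (1 - a%:MP * g) + a%:MP * (s ^+ N *: g - r).
    by rewrite -mul_mpolyC /q; ring.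
  by apply: ideal_add => //; apply: ideal_mull.
suff /(congr1 (mcoeff 0%MM)) : q = 0.
  rewrite mcoeffB mcoeffC eqxx mulr1 mcoeffCM mcoeff0 => /eqP.
  by rewrite subr_eq0 => /eqP.
apply/eqP; apply/negPn/negP => q0; have := mlead_supp q0.
move=> /msuppB_le; rewrite mem_cat => /orP[].
  rewrite msuppC; case: eqP => // _; rewrite inE => /eqP lead0.
  have qC : q = (mleadc q)%:MP.
    apply: etrans (msize1_polyC _) _; last by rewrite lead0.
    by rewrite -mlead_deg // lead0 mdeg0.
  by move: (q0); rewrite -mleadc_eq0 (MA (mleadc q)) ?eqxx // -qC.
rewrite mul_mpolyC => /msuppZ_le /red; apply.
by exists q.
Qed.

(** * Single variables and the Nullstellensatz *)

Lemma mpoly_rmorphism_ext (A S : comNzRingType) (m : nat)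
    (f g : {rmorphism {mpoly A[m]} -> S}) :
  (forall c, f c%:MP = g c%:MP) -> (forall i, f 'X_i = g 'X_i) -> f =1 g.
Proof.
move=> fgC fgX p; rewrite (mpolyE p) !rmorph_sum; apply: eq_bigr => a _.
rewrite -mul_mpolyC !rmorphM fgC mpolyXE_id !rmorph_prod; congr (_ * _).
by apply: eq_bigr => i _; rewrite !rmorphXn /= fgX.
Qed.

Lemma ideal_coefM (A : comNzRingType) (Q : A -> Prop) (p q : {poly A}) :
  is_ideal Q -> (forall k, Q q`_k) -> forall k, Q (p * q)`_k.
Proof.
move=> idQ Qq k; rewrite coefM; apply: (ideal_sum idQ) => i _.
exact: ideal_mull.
Qed.

Lemma ideal_horner (A : comNzRingType) (Q : A -> Prop) (p : {poly A}) x :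
  is_ideal Q -> (forall k, Q p`_k) -> Q p.[x].
Proof.
move=> idQ Qp; rewrite horner_coef; apply: (ideal_sum idQ) => i _.
exact: ideal_mulr.
Qed.

Lemma least_counterexample (P : nat -> Prop) :
  ~ (forall k, P k) -> exists2 i, ~ P i & forall j, (j < i)%N -> P j.
Proof.
move=> nP; have [i] : exists i, ~ P i by apply: not_all_ex_not.
elim/ltn_ind: i => i IHi nPi.
have [[j [ji nPj]]|noj] := classic (exists j, (j < i)%N /\ ~ P j); first exact: IHi nPj.
by exists i => // j ji; apply: NNPP => nPj; apply: noj; exists j.
Qed.

Lemma prime_coefs (A : comNzRingType) (Q : A -> Prop) (p q : {poly A}) :
  is_ideal Q -> (forall i j, Q (p`_i * q`_j) -> Q p`_i \/ Q q`_j) ->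
  (forall k, Q (p * q)`_k) -> (forall k, Q p`_k) \/ (forall k, Q q`_k).
Proof.
move=> idQ Qprime Qpq; apply: NNPP => /not_or_and[].
move=> /least_counterexample[i nQi Qi] /least_counterexample[j nQj Qj].
suff /Qprime[] : Q (p`_i * q`_j) by [].
have lt_i : (i < (i + j).+1)%N by rewrite ltnS leq_addr.
have := Qpq (i + j)%N; rewrite coefM (bigD1 (Ordinal lt_i)) //= addKn => Qs.
apply: (ideal_subl idQ _ Qs); rewrite addrAC subrr add0r; apply: (ideal_sum idQ) => k ki.
have [ltk|lek] := ltnP k i; first by apply: (ideal_mulr idQ); apply: Qi.
apply: (ideal_mull idQ); apply: Qj.
have : (k : nat) != i by apply: contraNneq ki => ki; apply/eqP/val_inj.
by have := ltn_ord k; lia.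
Qed.

Section SplitVariable.
Context {K : fieldType} {m : nat}.
Local Notation R := {mpoly K[m]}.
Implicit Types (E I Q M : R -> Prop) (f g : R) (i j : 'I_m) (p : {poly K}).

Definition split_var i : R -> {poly R} :=
  mmap (polyC \o @mpolyC m K) (fun j => if j == i then 'X else ('X_j)%:P).

HB.instance Definition _ i := GRing.RMorphism.copy (split_var i)
  (mmap (polyC \o @mpolyC m K) (fun j => if j == i then 'X else ('X_j)%:P)).

Definition poly_var i : {poly K} -> R := horner_eval 'X_i \o map_poly (@mpolyC m K).

HB.instance Definition _ i := GRing.RMorphism.copy (poly_var i)
  (horner_eval 'X_i \o map_poly (@mpolyC m K)).

Lemma split_varC i c : split_var i c%:MP = (c%:MP)%:P.
Proof. by rewrite /split_var mmapC. Qed.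

Lemma split_varX i : split_var i 'X_i = 'X.
Proof. by rewrite /split_var mmapX mmap1U eqxx. Qed.

Lemma split_varX_neq i j : j != i -> split_var i 'X_j = ('X_j)%:P.
Proof. by rewrite /split_var mmapX mmap1U => /negPf->. Qed.

Lemma split_varK i f : (split_var i f).['X_i] = f.
Proof.
rewrite -[_.[_]]/((horner_eval 'X_i \o split_var i) f) -[RHS]/(idfun f).
apply: mpoly_rmorphism_ext => [c|j] /=; first by rewrite split_varC horner_evalE hornerC.
rewrite horner_evalE; have [->|ji] := eqVneq j i; first by rewrite split_varX hornerX.
by rewrite split_varX_neq // hornerC.
Qed.

Lemma poly_varC i c : poly_var i c%:P = c%:MP.
Proof. by rewrite /poly_var /= map_polyC horner_evalE hornerC. Qed.

Lemma poly_varX i : poly_var i 'X = 'X_i.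
Proof. by rewrite /poly_var /= map_polyX horner_evalE hornerX. Qed.

Lemma split_var_poly_var i p : split_var i (poly_var i p) = map_poly (@mpolyC m K) p.
Proof.
elim/poly_ind: p => [|p c IHp]; first by rewrite !rmorph0.
by rewrite !rmorphD !rmorphM /= IHp poly_varX split_varX map_polyX poly_varC split_varC map_polyC.
Qed.

Lemma split_var_poly_var_neq i j p : j != i -> split_var i (poly_var j p) = (poly_var j p)%:P.
Proof.
move=> ji; elim/poly_ind: p => [|p c IHp]; first by rewrite !rmorph0.
by rewrite !rmorphD !rmorphM /= IHp poly_varX split_varX_neq // poly_varC split_varC.
Qed.

(* The ideal of R generated by the elements of Q that do not involve x_i. *)
Definition free_var i Q : R -> Prop := fun f => forall k, Q (split_var i f)`_k.

Definition extended i E : Prop := subideal E (free_var i E).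

Lemma free_var_ideal i Q : is_ideal Q -> is_ideal (free_var i Q).
Proof.
move=> idQ; split=> [k|f g Qf Qg k|f g Qg k].
- by rewrite rmorph0 coef0; apply: ideal_zero.
- by rewrite rmorphD coefD; apply: (ideal_add idQ); [apply: Qf | apply: Qg].
- by rewrite rmorphM /=; apply: (ideal_coefM _ idQ) => l; apply: Qg.
Qed.

Lemma free_var_sub i Q : is_ideal Q -> subideal (free_var i Q) Q.
Proof. by move=> idQ f Qf; rewrite -(split_varK i f); apply: ideal_horner. Qed.

Lemma free_var_prime i Q : is_prime Q -> is_prime (free_var i Q).
Proof.
move=> [idQ Q1 primeQ]; split; first exact: free_var_ideal.
- by move=> /(_ 0%N); rewrite rmorph1 coefC eqxx.
- move=> f g Qfg; apply: prime_coefs idQ _ _ => [k l /primeQ//|k].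
  by rewrite -rmorphM; apply: Qfg.
Qed.

Lemma extended_add_gen i E f : is_ideal E -> extended i E ->
  split_var i f = f%:P -> extended i (add_gen E f).
Proof.
move=> idE extE fE _ [u Eu [h ->]] k; rewrite rmorphD rmorphM /= fE coefD coefMC.
by exists (split_var i u)`_k; [apply: extE | exists (split_var i h)`_k].
Qed.

(* In the split form a top coefficient of p(x_i) g outside E would be a
   coefficient of g. *)
Lemma extended_regular i E p g : is_ideal E -> extended i E -> p \is monic ->
  E (poly_var i p * g) -> E g.
Proof.
move=> idE extE monp Epg; rewrite -(split_varK i g).
apply: ideal_horner => // k; set q := split_var i g.
have [l] := ubnPeq (size q - k)%N; elim/ltn_ind: l k => l IHl k lk.
have [ltk|lek] := ltnP k (size q); last by rewrite nth_default //; apply: ideal_zero.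
have IH k' : (k < k')%N -> E q`_k' by move=> kk'; apply: (IHl _ _ _ (eqxx _)); lia.
have := extE _ Epg ((size p).-1 + k)%N; rewrite rmorphM /= split_var_poly_var -/q coefM.
have lt_p : ((size p).-1 < ((size p).-1 + k).+1)%N by lia.
rewrite (bigD1 (Ordinal lt_p)) //= addKn coef_map /=.
rewrite -lead_coefE (monicP monp) mpolyC1 mul1r => Es.
apply: (ideal_subl idE _ Es); rewrite addrAC subrr add0r; apply: (ideal_sum idE) => j jp.
have [ltj|lej] := ltnP j (size p).-1; first apply: (ideal_mull idE).
  by apply: IH; rewrite -addnBAC ?(ltnW ltj) // -[X in (X < _)%N]add0n ltn_add2r subn_gt0.
rewrite coef_map /= nth_default; first by rewrite mul0r; apply: ideal_zero.
apply: leq_trans (leqSpred _) _; rewrite ltn_neqAle lej andbT eq_sym.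
by apply: contraNneq jp => jp; apply/eqP/val_inj.
Qed.

(* If no nonzero p(x_i) is in M, then all nonzero elements of K[x_i] are
   invertible modulo M, and some s in K[x_i] has powers divisible by all of
   them. But 1 + x_i s does not divide a power of s. *)
Lemma nullstellensatz i M : is_maximal M -> exists2 p, p \is monic & M (poly_var i p).
Proof.
move=> maxM; have [idM M1 _] := maxM; apply: NNPP => nop.
have Mi p : M (poly_var i p) -> p = 0.
  move=> Mp; apply: NNPP => /eqP p0; apply: nop; exists ((lead_coef p)^-1 *: p).
    by rewrite monicE lead_coefZ mulVf ?lead_coef_eq0.
  by rewrite -mul_polyC rmorphM /= poly_varC; apply: ideal_mull.
pose psi : {mpoly {poly K}[m]} -> R := mmap (poly_var i) (fun j => 'X_j).
have psiC a : psi a%:MP = poly_var i a by rewrite /psi mmapC.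
have psiK (g : R) : psi (map_mpoly polyC g) = g.
  rewrite -[LHS]/((mmap (poly_var i) (fun j => 'X_j) \o map_mpoly polyC) g) -[RHS]/(idfun g).
  apply: mpoly_rmorphism_ext => [c|j] /=; first by rewrite map_mpolyC mmapC /= poly_varC.
  by rewrite map_mpolyX mmapX mmap1U.
pose M' a := M (psi a).
have idM' : is_ideal M'.
  rewrite /M' /psi; split=> [|f g Mf Mg|f g Mg].
  - by rewrite raddf0; apply: ideal_zero.
  - by rewrite rmorphD; apply: ideal_add.
  - by rewrite rmorphM; apply: ideal_mull.
have [|a a0|s s0 sP] := divides_power_of_generic idM'.
- by move=> a; rewrite /M' psiC => /Mi.
- have /(maximal_inv maxM)[g Mg] : ~ M (poly_var i a) by move=> /Mi/eqP; rewrite (negPf a0).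
  exists (map_mpoly polyC g).
  by rewrite /M' /psi rmorphB rmorph1 rmorphM /= -/psi -/(psi _) psiK psiC.
have size_a : (1 < size ('X * s + 1)%R)%N.
  by rewrite mulrC size_polyDl size_mulX ?size_poly1 ?ltnS ?size_poly_gt0.
have [|N [b sN]] := sP ('X * s + 1); first by rewrite -size_poly_gt0; apply: ltnW.
have /coprimepP/(_ ('X * s + 1) (dvdpp _)) : coprimep ('X * s + 1) (s ^+ N).
  apply: coprimep_expr; apply/Bezout_eq1_coprimepP; exists (1, - 'X) => /=.
  by ring.
rewrite sN dvdp_mulr // => /(_ isT); rewrite -size_poly_eq1 => /eqP size1.
by rewrite size1 in size_a.
Qed.

End SplitVariable.

(** * Growth of residue rings *)

Section Growth.
Context {K : fieldType} {m : nat}.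
Local Notation R := {mpoly K[m]}.
Implicit Types (I J P : R -> Prop) (f g : R).

(* The image in R/I of the polynomials of degree at most t has dimension at
   least N. *)
Definition dim_ge I (t N : nat) : Prop :=
  exists2 s : 'I_N -> R, forall i, (msize (s i) <= t.+1)%N &
    forall c : 'I_N -> K, I (\sum_i c i *: s i) -> forall i, c i = 0.

Definition growth_le I (k : nat) : Prop :=
  exists C, forall t N, dim_ge I t N -> (N <= C * t.+1 ^ k)%N.

Definition regular_mod I f : Prop := forall g, I (f * g) -> I g.

Lemma growth_le_sub I J k : subideal I J -> growth_le I k -> growth_le J k.
Proof.
move=> IJ [C CP]; exists C => t N [s sz indep]; apply: CP; exists s => // c Ic.
exact/indep/IJ.
Qed.

Lemma dim_ge_regular I J f e t N q : is_ideal I -> is_ideal J -> regular_mod I f ->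
  subideal I J -> J f -> (msize f <= e.+1)%N ->
  dim_ge J t N -> dim_ge I (t + q * e) (q.+1 * N).
Proof.
move=> idI idJ regf IJ Jf sz_f [s sz indep]; elim: q => [|q [s' sz' indep']].
  by rewrite mul0n addn0 mul1n; exists s => // c /IJ; apply: indep.
rewrite (mulSn q e) (mulSn q.+1 N).
pose F i := match split i with inl j => s j | inr j => f * s' j end.
exists F => [i|c].
  rewrite /F; case: split => j.
    by apply: leq_trans (sz j) _; rewrite ltnS leq_addr.
  have [->|f0] := eqVneq f 0; first by rewrite mul0r msize0.
  have [->|s0] := eqVneq (s' j) 0; first by rewrite mulr0 msize0.
  rewrite msizeM //; move: (msize f) (msize (s' j)) sz_f (sz' j) => a b; clear; lia.
have Fl j : F (lshift _ j) = s j.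
  by rewrite /F -[lshift _ j]/(unsplit (inl j)) unsplitK.
have Fr j : F (rshift _ j) = f * s' j.
  by rewrite /F -[rshift _ j]/(unsplit (inr j)) unsplitK.
rewrite big_split_ord /= => Ic.
have sumr : \sum_j c (rshift N j) *: F (rshift N j) = f * \sum_j c (rshift N j) *: s' j.
  by rewrite mulr_sumr; apply: eq_bigr => j _; rewrite Fr scalerAr.
rewrite sumr in Ic.
have cl j : c (lshift _ j) = 0.
  move: j; apply: indep; under eq_bigr => j _ do rewrite -Fl.
  apply: (ideal_subr idJ (g := - (f * \sum_j c (rshift N j) *: s' j))).
    by rewrite opprK; apply: IJ.
  by apply: (ideal_opp idJ); apply: (ideal_mulr idJ).
have cr : forall j, c (rshift _ j) = 0.
  apply: indep'; apply: regf; move: Ic; rewrite big1 ?add0r // => j _.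
  by rewrite cl scale0r.
by move=> i; rewrite -[i]splitK; case: split => j; [apply: cl | apply: cr].
Qed.

Lemma growth_le_regular I J f k : is_ideal I -> is_ideal J -> regular_mod I f ->
  subideal I J -> J f -> growth_le I k.+1 -> growth_le J k.
Proof.
move=> idI idJ regf IJ Jf [C CP]; set e := msize f.
exists (C * e.+1 ^ k.+1)%N => t N /(@dim_ge_regular _ _ f e _ _ t idI idJ regf IJ Jf (leqnSn _)).
move=> /CP le_N; rewrite -(leq_pmul2l (ltn0Sn t)); apply: leq_trans le_N _.
rewrite [leqRHS](_ : _ = C * (t.+1 * e.+1) ^ k.+1)%N; last first.
  by rewrite expnMn (expnS t.+1) -(mulnA C) mulnCA (mulnCA t.+1) [in RHS](mulnC (_ * _)%N).
by rewrite leq_mul2l leq_exp2r //; apply/orP; right; nia.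
Qed.

Lemma growth_le0_regular I J f : is_ideal I -> is_ideal J -> regular_mod I f ->
  subideal I J -> J f -> growth_le I 0 -> J 1.
Proof.
move=> idI idJ regf IJ Jf [C CP]; apply: NNPP => J1.
have one : dim_ge J 0 1.
  exists (fun=> 1) => [i|c]; first by rewrite msize1.
  rewrite big_ord1 => Jc i; apply/eqP; apply: contraPT Jc => c0 Jc; apply: J1.
  by rewrite ord1 in c0; rewrite -[1](scalerK c0) -mul_mpolyC; apply: ideal_mull.
have := CP _ _ (@dim_ge_regular _ _ f _ _ _ C idI idJ regf IJ Jf (leqnSn _) one).
by rewrite expn0 !muln1 ltnn.
Qed.

Lemma growth_le_zero : growth_le (@zero_ideal R) m.
Proof.
exists 1%N => t N [s sz indep]; rewrite mul1n.
pose T := {ffun 'I_m -> 'I_t.+1}.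
pose mon (a : T) : 'X_{1..m} := [multinom a i : nat | i < m].
pose A := \matrix_(i < N, j < #|T|) (s i)@_(mon (enum_val j)).
suff /eqP <- : row_free A.
  by rewrite (leq_trans (rank_leq_col _)) // card_ffun !card_ord.
apply: inj_row_free => v vA; apply/rowP => i; rewrite mxE; apply: (indep (v 0)).
apply/mpolyP => a; rewrite mcoeff0 raddf_sum /=.
have [lta|lea] := ltnP (mdeg a) t.+1; last first.
  apply: big1 => j _; rewrite mcoeffZ memN_msupp_eq0 ?mulr0 //.
  exact: msize_mdeg_ge (leq_trans (sz j) lea).
have lt_a j : (a j < t.+1)%N.
  by apply: leq_ltn_trans lta; rewrite mdegE (bigD1 j) //= leq_addr.
have mon_a : mon [ffun j => Ordinal (lt_a j)] = a.
  by apply/mnmP => j; rewrite mnmE ffunE.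
have /matrixP/(_ 0 (enum_rank [ffun j => Ordinal (lt_a j)])) := vA; rewrite !mxE.
by move=> vA0; rewrite -[RHS]vA0; apply: eq_bigr => j _; rewrite mcoeffZ mxE enum_rankK mon_a.
Qed.

Lemma growth_le_height I P k d : is_ideal I -> growth_le I d -> height_ge I P k ->
  (k <= d)%N /\ growth_le P (d - k).
Proof.
move=> idI gI [Q [primeQ IQ chainQ QP]].
have gQ0 : growth_le (Q 0%N) d by apply: growth_le_sub gI.
suff [le_kd gQ] : (k <= d)%N /\ growth_le (Q k) (d - k).
  by split=> //; apply: growth_le_sub gQ => f /QP.
clear QP; elim: k primeQ chainQ => [|k IHk] primeQ chainQ; first by rewrite subn0.
have [|j jk|le_kd gQk] := IHk.
- by move=> j jk; apply: primeQ; apply: leqW.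
- by apply: chainQ; apply: leqW.
have [Qk_sub /not_subidealP[f Qf nQf]] := chainQ k (ltnSn k).
have [idQ _ Qprime] := primeQ k (leqnSn k); have [idQ' Q'1 _] := primeQ _ (leqnn k.+1).
have regf : regular_mod (Q k) f by move=> g /Qprime[].
have [dk|dk] := posnP (d - k).
  case: Q'1; apply: (growth_le0_regular idQ idQ' regf) => //.
  by rewrite dk in gQk.
split; first by rewrite -subn_gt0.
apply: (growth_le_regular idQ idQ' regf) => //.
by rewrite subnS prednK.
Qed.

Lemma regular_seq_proper I s : is_ideal I -> regular_seq I s -> ~ I 1.
Proof.
elim: s I => [|f s IHs] I idI //= [_ /IHs nJ1] I1.
by apply: nJ1; [apply: add_gen_ideal | apply: add_gen_sub].
Qed.

Lemma growth_le_regular_seq I s d : is_ideal I -> growth_le I d -> regular_seq I s ->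
  (size s <= d)%N.
Proof.
elim: s I d => [//|f s IHs] I d idI gI /= [regf reg_s].
have idJ := add_gen_ideal idI f.
case: d gI => [|d] gI.
  have J1 := growth_le0_regular idI idJ regf (@add_gen_sub _ _ f) (add_gen_mem idI f) gI.
  by case: (regular_seq_proper idJ reg_s J1).
apply: (IHs _ _ idJ _ reg_s).
exact: (growth_le_regular idI idJ regf (@add_gen_sub _ _ f) (add_gen_mem idI f) gI).
Qed.

End Growth.

(** * Hilbert functions *)

Lemma vspace_of_pred (K : fieldType) (V : vectType K) (P : V -> Prop) :
  P 0 -> (forall a u v, P u -> P v -> P (a *: u + v)) ->
  exists U : {vspace V}, forall v, v \in U <-> P v.
Proof.
move=> P0 Plin; suff /(_ (\dim {:V}).+1)[U [UP]] : forall k, exists U : {vspace V},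
    (forall v, v \in U -> P v) /\ ((k <= \dim U)%N \/ forall v, P v -> v \in U).
  by case=> [|PU]; [rewrite ltnNge dimvS ?subvf | exists U; split; [apply: UP | apply: PU]].
elim=> [|k [U [UP [kU|PU]]]].
- exists 0%VS; split; last by left.
  by move=> v; rewrite memv0 => /eqP->.
- have [PU|nPU] := classic (forall v, P v -> v \in U); first by exists U; split=> //; right.
  have [v Pv nUv] : exists2 v, P v & v \notin U.
    apply: NNPP => nov; apply: nPU => v Pv; apply/negPn/negP => nUv.
    by apply: nov; exists v.
  exists (U + <[v]>)%VS; split=> [_ /memv_addP[u Uu [_ /vlineP[a ->] ->]]|].
    by rewrite addrC; apply: Plin => //; apply: UP.
  left; apply: leq_ltn_trans kU _; rewrite ltn_neqAle dimvS ?addvSl // andbT.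
  apply: contra nUv => /eqP dimE.
  have /eqP-> : U == (U + <[v]>)%VS by rewrite eqEdim addvSl -dimE leqnn.
  by apply: subvP (addvSr _ _) _ (memv_line v).
- by exists U; split=> //; right.
Qed.

Section Homogeneous.
Context {K : fieldType} {m : nat}.
Local Notation R := {mpoly K[m]}.
Implicit Types (I J : R -> Prop) (f g h : R).
Local Notation pi d f := (pihomog mdeg d f).

Lemma pihomogM_homog e f g t : g \is e.-homog -> pi (t + e) (f * g) = pi t f * g.
Proof.
move=> g_hom; have szE := leqnn (msize f).
rewrite [in LHS](pihomog_partitionE szE) [in RHS](pihomog_partitionE szE).
rewrite mulr_suml !raddf_sum mulr_suml /=; apply: eq_bigr => d _.
have dg_hom : pi d f * g \is (d + e).-homog by apply: dhomogM (pihomogP _ _ _) g_hom.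
have [<-|dt] := eqVneq (d : nat) t; first by rewrite pihomog_id pihomog_dE.
by rewrite (pihomog_ne0 dt (pihomogP _ _ _)) mul0r (pihomog_ne0 _ dg_hom) // eqn_add2r.
Qed.

Lemma pihomogM_homog_lt e f g t : g \is e.-homog -> (t < e)%N -> pi t (f * g) = 0.
Proof.
move=> g_hom te; rewrite [f](pihomog_partitionE (leqnn (msize f))).
rewrite mulr_suml raddf_sum /=; apply: big1 => d _.
have dg_hom : pi d f * g \is (d + e).-homog by apply: dhomogM (pihomogP _ _ _) g_hom.
by rewrite (pihomog_ne0 _ dg_hom) //; apply: contraTneq te => <-; rewrite -leqNgt leq_addl.
Qed.

Lemma pihomogM k f g : pi k (f * g) = \sum_(i < k.+1) pi i f * pi (k - i) g.
Proof.
have pi0 d f' : (msize f' <= d)%N -> pi d f' = 0.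
  move=> szd; rewrite pihomogE big_seq_cond big1 // => a /andP[/msize_mdeg_lt + /eqP e].
  by rewrite e ltnNge szd.
have pif : f = \sum_(i < maxn (msize f) k.+1) pi i f.
  by apply: pihomog_partitionE; rewrite leq_maxl.
rewrite [in LHS]pif mulr_suml raddf_sum /=.
rewrite (big_ord_widen _ (fun i => pi i f * pi (k - i) g) (leq_maxr (msize f) k.+1)).
rewrite [RHS]big_mkcond /=; apply: eq_bigr => i _; rewrite [pi i f * g]mulrC ltnS.
case: leqP => [ik|ki]; last by rewrite (pihomogM_homog_lt _ (pihomogP _ _ _)).
by rewrite -[X in pi X _](subnK ik) (pihomogM_homog _ _ (pihomogP _ _ _)) mulrC.
Qed.

Lemma homogeneousP I f : is_ideal I -> (forall d, I (pi d f)) -> I f.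
Proof.
move=> idI If; rewrite (pihomog_partitionE (leqnn (msize f))).
exact: (ideal_sum idI).
Qed.

(* The coefficients in T of the image of f under x_i |-> x_i T are the
   homogeneous components of f. *)
Definition component_poly f : {poly R} := \poly_(k < msize f) pi k f.

Lemma coef_component_poly f k : (component_poly f)`_k = pi k f.
Proof.
rewrite coef_poly; case: ltnP => // sz_k; rewrite pihomogE big_seq_cond big1 // => a.
by move=> /andP[/msize_mdeg_lt + /eqP e]; rewrite e ltnNge sz_k.
Qed.

Lemma homogeneous_prime I : is_ideal I -> (forall d f, I f -> I (pi d f)) -> ~ I 1 ->
  (forall d e f g, f \is d.-homog -> g \is e.-homog -> I (f * g) -> I f \/ I g) ->
  is_prime I.
Proof.
move=> idI homI I1 primeI; split=> // f g Ifg.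
have [||If|Ig] := @prime_coefs _ I (component_poly f) (component_poly g) idI.
- move=> i j; rewrite !coef_component_poly.
  exact: primeI (pihomogP _ _ _) (pihomogP _ _ _).
- move=> k; rewrite coefM; under eq_bigr do rewrite !coef_component_poly.
  by rewrite -pihomogM; apply: homI.
- by left; apply: homogeneousP => // d; rewrite -coef_component_poly.
- by right; apply: homogeneousP => // d; rewrite -coef_component_poly.
Qed.

End Homogeneous.

Section Hilbert.
Context {K : fieldType} {n : nat}.
Local Notation R := {mpoly K[n.+1]}.
Local Notation form := (dhomog n.+1 K).
Implicit Types (I J : R -> Prop) (f g h : R).
Local Notation pi d f := (pihomog mdeg d f).

Definition hilb I (t : nat) : nat := epsilon (inhabits 0%N) (hilbert_value I t).

Lemma vspace_of_ideal I t : is_ideal I ->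
  exists V : {vspace form t}, forall f : form t, f \in V <-> I (val f).
Proof.
move=> idI; apply: (@vspace_of_pred _ _ (fun f : form t => I (val f))).
  exact: (ideal_zero idI).
move=> a u v Iu Iv; rewrite linearP /= -mul_mpolyC.
by apply: ideal_add => //; apply: ideal_mull.
Qed.

Lemma hilbE I t (V : {vspace form t}) : (forall f : form t, f \in V <-> I (val f)) ->
  (\dim V + hilb I t)%N = \dim {:form t}.
Proof.
move=> VI; have exk : exists k, hilbert_value I t k.
  by exists (\dim {:form t} - \dim V)%N, V => //; rewrite subnKC // dimvS // subvf.
have := epsilon_spec (inhabits 0%N) _ exk; rewrite -/(hilb I t) => -[W WI <-].
suff -> : V = W by [].
apply/vspaceP => f; apply/idP/idP => [/VI/WI//|/WI/VI//].
Qed.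

Lemma hilb_value I t : is_ideal I -> hilbert_value I t (hilb I t).
Proof. by move=> idI; have [V VI] := vspace_of_ideal t idI; exists V => //; apply: hilbE. Qed.

Lemma eq_hilb I J t : is_ideal I -> (forall f : form t, I (val f) <-> J (val f)) ->
  hilb I t = hilb J t.
Proof.
move=> idI IJ; have [V VI] := vspace_of_ideal t idI.
by apply/(@addnI (\dim V)); rewrite !hilbE // => f; rewrite VI.
Qed.

Lemma hilb_all I t : (forall f : form t, I (val f)) -> hilb I t = 0%N.
Proof.
move=> It; apply/(@addnI (\dim {:form t})); rewrite hilbE ?addn0 // => f.
by rewrite memvf.
Qed.

Lemma colon_homogeneous I e (f : form e) : homogeneous_ideal I ->
  homogeneous_ideal (colon I (val f)).
Proof.
move=> [idI homI]; split; first exact: colon_ideal.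
move=> d g; rewrite /colon => /(homI (d + e)%N).
by rewrite (mulrC (val f) g) (mulrC (val f) (pi d g)) (pihomogM_homog _ _ (dhomog_is_dhomog f)).
Qed.

Lemma add_gen_homogeneous I e (f : form e) : homogeneous_ideal I ->
  homogeneous_ideal (add_gen I (val f)).
Proof.
move=> [idI homI]; split; first exact: add_gen_ideal.
move=> d _ [u Iu [h ->]]; rewrite raddfD /=; exists (pi d u); first exact: homI.
have [de|ed] := ltnP d e.
  by exists 0; rewrite mul0r (pihomogM_homog_lt _ (dhomog_is_dhomog f)).
by exists (pi (d - e) h); rewrite -(pihomogM_homog _ _ (dhomog_is_dhomog f)) subnK.
Qed.

Lemma hilb_add_gen_low I e (f : form e) t : homogeneous_ideal I -> (t < e)%N ->
  hilb (add_gen I (val f)) t = hilb I t.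
Proof.
move=> [idI homI] te; apply: eq_hilb; first exact: add_gen_ideal.
move=> g; split; last exact: add_gen_sub.
move=> [u Iu [h gE]]; rewrite -(pihomog_dE (dhomog_is_dhomog g)) gE raddfD /=.
by rewrite (pihomogM_homog_lt _ (dhomog_is_dhomog f)) // addr0; apply: homI.
Qed.

Lemma form_mul_proof d e (f : form d) (g : form e) : val g * val f \is (e + d).-homog.
Proof. exact: dhomogM (dhomog_is_dhomog g) (dhomog_is_dhomog f). Qed.

Definition form_mul e d (f : form d) (g : form e) : form (e + d) :=
  DHomog (form_mul_proof f g).

Lemma form_mul_is_linear e d (f : form d) : linear (@form_mul e d f).
Proof. by move=> a g h; apply/val_inj; rewrite /= mulrDl scalerAl. Qed.

HB.instance Definition _ e d (f : form d) :=
  GRing.isLinear.Build K (form e) (form (e + d)) _ (@form_mul e d f)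
    (@form_mul_is_linear e d f).

Lemma hilb_add_gen I e (f : form e) t : homogeneous_ideal I ->
  hilb I (t + e) = (hilb (colon I (val f)) t + hilb (add_gen I (val f)) (t + e))%N.
Proof.
move=> homI; have [idI piI] := homI.
have [V VI] := vspace_of_ideal (t + e) idI.
pose L := linfun (@form_mul t e f).
have LE u : val (L u) = val f * val u by rewrite lfunE /= mulrC.
pose C := (L @^-1: V)%VS; pose J := (V + limg L)%VS.
have CP : forall u : form t, u \in C <-> colon I (val f) (val u).
  by move=> u; rewrite /C -memv_preim VI LE.
have JP : forall u : form (t + e), u \in J <-> add_gen I (val f) (val u).
  move=> u; split=> [/memv_addP[v /VI Iv [_ /memv_imgP[w _ ->] ->]]|[v Iv [h uE]]].
    by exists (val v) => //; exists (val w); rewrite raddfD /= LE mulrC.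
  apply/memv_addP; exists (DHomog (pihomogP mdeg (t + e) v)).
    by apply/VI; apply: piI.
  exists (L (DHomog (pihomogP mdeg t h))); first exact: memv_img (memvf _).
  apply/val_inj; rewrite raddfD /= LE /= -{1}(pihomog_dE (dhomog_is_dhomog u)) uE raddfD /=.
  by rewrite (pihomogM_homog _ _ (dhomog_is_dhomog f)) mulrC.
have := hilbE VI; have := hilbE CP; have := hilbE JP.
have capE : (V :&: limg L = L @: C)%VS by rewrite /C -lpreim_cap_limg lpreimK // capvSr.
have kerC : (lker L <= C)%VS.
  by apply/subvP => u; rewrite memv_ker -memv_preim => /eqP->; rewrite mem0v.
have := dimv_sum_cap V (limg L); rewrite capE -/J.
have := limg_ker_dim L C; rewrite (capv_idPr kerC).
have := limg_ker_dim L fullv; rewrite (capv_idPr (subvf _)).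
move: (\dim _) (\dim (L @: C)) (\dim _) (\dim C) (\dim _) (\dim J) (\dim V) (\dim _).
by move=> *; lia.
Qed.

End Hilbert.

Definition diff (g : nat -> int) : nat -> int :=
  fun t => g t - (if t is s.+1 then g s else 0).

Definition shift (e : nat) (g : nat -> int) : nat -> int :=
  fun t => if (t < e)%N then 0 else g (t - e)%N.

Definition finsupp_fun (g : nat -> int) : Prop :=
  exists B, forall t, (B <= t)%N -> g t = 0.

Lemma eq_iter_diff k g h : g =1 h -> iter k diff g =1 iter k diff h.
Proof.
move=> gh; elim: k => [|k IHk] t //=.
by rewrite /diff IHk; case: t => // t; rewrite IHk.
Qed.

Lemma iter_diffD k g h t :
  iter k diff (fun t => g t + h t) t = iter k diff g t + iter k diff h t.
Proof.
elim: k t => [|k IHk] t //=; rewrite /diff IHk.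
case: t => [|t]; first by rewrite !subr0.
by rewrite IHk opprD addrACA.
Qed.

Lemma diff_shift e g : diff (shift e g) =1 shift e (diff g).
Proof.
move=> t; rewrite /diff /shift; case: ltnP => [te|et].
  by case: t te => [|t] te; rewrite ?(ltnW te) subrr.
case: t et => [|t] et; first by rewrite sub0n.
case: ltnP => [te|{}et]; last by rewrite subSn.
by have -> : (e = t.+1)%N; [lia | rewrite subnn].
Qed.

Lemma iter_diff_shift k e g t : iter k diff (shift e g) t = shift e (iter k diff g) t.
Proof.
elim: k t => [//|k IHk] t; rewrite iterS -diff_shift /diff IHk.
by case: t => // t; rewrite IHk.
Qed.

Lemma finsupp_iter_diff k g : finsupp_fun g -> finsupp_fun (iter k diff g).
Proof.
move=> g0; elim: k => [//|k [B gB]]; exists B.+1 => -[//|t] Bt /=.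
by rewrite /diff !gB ?subrr // ltnW.
Qed.

Lemma finsupp_shift e g : finsupp_fun g -> finsupp_fun (shift e g).
Proof.
by move=> [B gB]; exists (B + e)%N => t Bt; rewrite /shift; case: ifP => // _; apply: gB; lia.
Qed.

Lemma finsupp_add g h : finsupp_fun g -> finsupp_fun h -> finsupp_fun (fun t => g t + h t).
Proof.
move=> [B gB] [C hC]; exists (B + C)%N => t BCt.
by rewrite gB ?hC ?addr0 //; lia.
Qed.

Lemma eq_finsupp g h : g =1 h -> finsupp_fun h -> finsupp_fun g.
Proof. by move=> gh [B hB]; exists B => t /hB; rewrite gh. Qed.

Section HilbertSeries.
Context {K : fieldType} {n : nat}.
Local Notation R := {mpoly K[n.+1]}.
Local Notation form := (dhomog n.+1 K).
Implicit Types (I J P : R -> Prop) (f g h : R).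

Definition hilbz I (t : nat) : int := (hilb I t)%:Z.

Lemma hilbz_exact I e (f : form e) t : homogeneous_ideal I ->
  hilbz I t = shift e (hilbz (colon I (val f))) t + hilbz (add_gen I (val f)) t.
Proof.
move=> homI; rewrite /shift; case: ltnP => [te|et].
  by rewrite add0r /hilbz hilb_add_gen_low.
by rewrite /hilbz -[in LHS](subnK et) (hilb_add_gen f _ homI) subnK.
Qed.

Lemma hilbz_regular I e (f : form e) t : homogeneous_ideal I -> regular_mod I (val f) ->
  hilbz (add_gen I (val f)) t = hilbz I t - shift e (hilbz I) t.
Proof.
move=> homI regf; have [idI _] := homI; rewrite (hilbz_exact f t homI).
have -> : shift e (hilbz (colon I (val f))) t = shift e (hilbz I) t.
  rewrite /shift /hilbz; case: ifP => // _; congr (Posz _); apply: eq_hilb.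
    exact: colon_ideal.
  by move=> g; split; [apply: regf | apply: colon_sub].
by rewrite addrC addKr.
Qed.

Lemma var_form_proof (i : 'I_n.+1) : ('X_i : R) \is 1.-homog.
Proof. by rewrite dhomogX /= mdeg1. Qed.

Definition var_form (i : 'I_n.+1) : form 1 := DHomog (var_form_proof i).

Lemma homogeneous_unit I (f : R) e : homogeneous_ideal I -> (0 < e)%N -> f \is e.-homog ->
  add_gen I f 1 -> I 1.
Proof.
move=> [idI homI] e0 f_hom [u Iu [h one]].
have := homI 0%N u Iu; suff -> : pihomog mdeg 0 u = 1 by [].
have <- : pihomog mdeg 0 (1 : R) = 1 by apply/pihomog_dE/dhomog1.
by rewrite one raddfD /= (pihomogM_homog_lt _ f_hom) // addr0.
Qed.

Lemma hilb_irrelevant I t : is_ideal I -> (forall i : 'I_n.+1, I 'X_i) -> (0 < t)%N ->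
  hilb I t = 0%N.
Proof.
move=> idI IX t0; apply: hilb_all => f; rewrite (mpolyE (val f)) big_seq.
apply: (ideal_sum idI) => a /(dhomogP _ _ _ (dhomog_is_dhomog f)) /= dega.
rewrite -mul_mpolyC; apply: (ideal_mull idI).
have [i ai] : exists i, a i != 0%N.
  apply/existsP; apply: contraTT t0 => /existsPn a0; rewrite -dega mdegE.
  by rewrite big1 // => i _; apply/eqP/negPn/a0.
have -> : a = (a - U_(i) + U_(i))%MM by rewrite submK // lep1mP.
by rewrite mpolyXD; apply: ideal_mull.
Qed.

(* For a homogeneous prime I other than the irrelevant ideal a variable is
   regular modulo I; otherwise I : f and I + (f) are larger for some form f. *)
Lemma hilbert_series_or_prime I k : homogeneous_ideal I ->
  finsupp_fun (iter k diff (hilbz I)) \/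
  exists P, [/\ is_prime P, subideal I P & ~ growth_le P k].
Proof.
move=> homI; have [idI _] := homI; move: I idI homI k; apply: noetherian_ind.
move=> I idI IH homI k; have [_ piI] := homI.
have [I1|I1] := classic (I 1).
  left; apply: finsupp_iter_diff; exists 0%N => t _.
  by rewrite /hilbz hilb_all // => f; apply: ideal1.
have [[d [e [f [g [If Ig Ifg]]]]]|primeI] := classic (exists d e (f : form d) (g : form e),
    [/\ ~ I (val f), ~ I (val g) & I (val f * val g)]).
  have sub_prime J : subideal I J -> (exists P, [/\ is_prime P, subideal J P & ~ growth_le P k]) ->
      exists P, [/\ is_prime P, subideal I P & ~ growth_le P k].
    by move=> IJ [P [primeP JP gP]]; exists P; split=> // h /IJ /JP.
  have subC := colon_sub idI (val f); have subA := @add_gen_sub _ I (val f).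
  have nCI : ~ subideal (colon I (val f)) I by move=> CI; apply/Ig/CI.
  have nAI : ~ subideal (add_gen I (val f)) I by move=> AI; apply/If/AI/add_gen_mem.
  have [finC|/(sub_prime _ subC)] :=
    IH _ (colon_ideal idI _) subC nCI (colon_homogeneous f homI) k; last by right.
  have [finA|/(sub_prime _ subA)] :=
    IH _ (add_gen_ideal idI _) subA nAI (add_gen_homogeneous f homI) k; last by right.
  left; apply: (eq_finsupp (h := fun t => shift d (iter k diff (hilbz (colon I (val f)))) t
                     + iter k diff (hilbz (add_gen I (val f))) t)).
    move=> t; rewrite -iter_diff_shift -iter_diffD.
    by apply: eq_iter_diff => s; apply: hilbz_exact.
  by apply: finsupp_add => //; apply: finsupp_shift.
have pI : is_prime I.
  apply: homogeneous_prime => // d e f g f_hom g_hom Ifg; apply: NNPP => /not_or_and[If Ig].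
  by apply: primeI; exists d, e, (DHomog f_hom), (DHomog g_hom).
have [gI|gI] := classic (growth_le I k); last by right; exists I; split.
have [IX|nIX] := classic (forall i : 'I_n.+1, I 'X_i).
  left; apply: finsupp_iter_diff; exists 1%N => t t0.
  by rewrite /hilbz hilb_irrelevant.
have [i Ii] : exists i : 'I_n.+1, ~ I 'X_i by apply: not_all_ex_not.
have regX : regular_mod I (val (var_form i)) by case: pI => _ _ pI g /pI[].
have subA := @add_gen_sub _ I (val (var_form i)).
have idA := add_gen_ideal idI (val (var_form i)).
have memA := add_gen_mem idI (val (var_form i)).
case: k gI => [|k] gI.
  case: I1; apply: (homogeneous_unit (f := 'X_i) (e := 1)) => //.
    exact: dhomog_is_dhomog (var_form i).
  exact: (growth_le0_regular idI idA regX subA memA gI).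
have gA := growth_le_regular idI idA regX subA memA gI.
have nAI : ~ subideal (add_gen I (val (var_form i))) I by move=> AI; apply/Ii/AI.
have [finA|[P [_ AP []]]] := IH _ idA subA nAI (add_gen_homogeneous (var_form i) homI) k.
  left; apply: eq_finsupp finA => t; rewrite iterSr.
  apply: eq_iter_diff => s; rewrite (hilbz_regular _ homI regX) /diff /shift.
  by case: s => [|s]; rewrite ?subn1.
exact: growth_le_sub gA.
Qed.

Lemma hilbert_series_codim2 I : homogeneous_ideal I -> codim_ge I 2 ->
  finsupp_fun (iter n.-1 diff (hilbz I)).
Proof.
move=> homI codimI; have [//|[P [primeP IP []]]] := hilbert_series_or_prime n.-1 homI.
have [_] := growth_le_height zero_idealP growth_le_zero (codimI P primeP IP).
by rewrite subSS subn1.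
Qed.

End HilbertSeries.

(** * General linear forms *)

Lemma seq_of_infinite (K : eqType) (N : nat) : (forall s : seq K, exists x, x \notin s) ->
  exists2 s : seq K, uniq s & size s = N.
Proof.
move=> infK; elim: N => [|N [s us sN]]; first by exists [::].
by have [x xs] := infK s; exists (x :: s); rewrite /= ?xs ?us ?sN.
Qed.

Section Evaluation.
Context {K : fieldType} {m : nat}.
Hypothesis infK : forall s : seq K, exists x, x \notin s.
Local Notation R := {mpoly K[m]}.

Lemma nonroot_const (P : {poly R}) : P != 0 -> exists x : K, P.[x%:MP] != 0.
Proof.
move=> P0; have [s us szs] := seq_of_infinite (size P) infK.
apply: NNPP => nox; have : (size (map (@mpolyC m K) s) < size P)%N.
  apply: max_poly_roots => //; last by rewrite map_inj_uniq //; apply: can_inj (@mpolyCK m K).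
  apply/allP => _ /mapP[x _ ->]; rewrite rootE; apply/negPn/negP => Px.
  by apply: nox; exists x.
by rewrite size_map szs ltnn.
Qed.

Lemma nonvanishing_point (p : R) : p != 0 -> exists v : 'I_m -> K, p.@[v] != 0.
Proof.
move=> p0.
pose ev (l : nat) (v : 'I_m -> K) : R -> R :=
  mmap (@mpolyC m K) (fun i => if (i < l)%N then (v i)%:MP else 'X_i).
suff /(_ m (leqnn m)) [v vP] : forall l, (l <= m)%N -> exists v, ev l v p != 0.
  exists v; apply: contraNneq vP => pv0; rewrite /ev.
  rewrite (mpoly_rmorphism_ext (g := @mpolyC m K \o meval v)) /=; first by rewrite pv0 mpolyC0.
    by move=> c; rewrite mmapC mevalC.
  by move=> i; rewrite mmapX mmap1U ltn_ord mevalXU.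
elim=> [|l IHl] lm.
  exists (fun=> 0); rewrite /ev.
  rewrite (mpoly_rmorphism_ext (g := idfun)) //= => [c|i]; first by rewrite mmapC.
  by rewrite mmapX mmap1U.
have [v evl] := IHl (ltnW lm); pose i0 := Ordinal lm.
have : split_var i0 (ev l v p) != 0.
  by apply: contraNneq evl => s0; rewrite -(split_varK i0 (ev l v p)) s0 horner0.
move=> /nonroot_const[x]; pose v' i := if i == i0 then x else v i.
move=> evx; exists v'; move: evx; congr (_ != _).
rewrite -[LHS]/((horner_eval x%:MP \o split_var i0 \o
  mmap (@mpolyC m K) (fun i => if (i < l)%N then (v i)%:MP else 'X_i)) p).
apply: mpoly_rmorphism_ext => [c|i] /=.
  by rewrite !mmapC split_varC horner_evalE hornerC.
rewrite !mmapX !mmap1U horner_evalE /v' ltnS [(i <= l)%N]leq_eqVlt.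
have [->|ii0] := eqVneq i i0.
  by rewrite /= ltnn eqxx split_varX hornerX.
rewrite (_ : (i == l :> nat) = false) /=; last by apply: contraNF ii0 => /eqP il; apply/eqP/val_inj.
case: ifP => _; first by rewrite split_varC hornerC.
by rewrite split_varX_neq // hornerC.
Qed.

End Evaluation.

Section LinearForms.
Context {K : fieldType} {n : nat}.
Local Notation R := {mpoly K[n.+1]}.
Local Notation form := (dhomog n.+1 K).
Implicit Types (I J : R -> Prop) (f g h : R).

Lemma linear_formE (G : form 1) : val G = \sum_i (val G)@_U_(i) *: 'X_i.
Proof.
apply/mpolyP => a; rewrite raddf_sum /=.
have [/eqP|dega] := eqVneq (mdeg a) 1%N.
  move=> /mdeg1P[j /eqP->]; rewrite (bigD1 j) //= mcoeffZ mcoeffX eqxx mulr1.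
  by rewrite big1 ?addr0 // => i ij; rewrite mcoeffZ mcoeffXU (negPf ij) mulr0.
rewrite (dhomog_nemf_coeff (dhomog_is_dhomog G) dega) big1 // => i _.
rewrite mcoeffZ mcoeffX; case: eqP => [e|]; last by rewrite mulr0.
by rewrite -e mdeg1 eqxx in dega.
Qed.

Lemma linear_form_eval (G : form 1) (v : 'I_n.+1 -> K) :
  (val G).@[v] = \sum_i (val G)@_U_(i) * v i.
Proof.
rewrite [in LHS]linear_formE raddf_sum /=; apply: eq_bigr => i _.
by rewrite mevalZ mevalXU.
Qed.

Lemma linear_form_evalD (G : form 1) (v w : 'I_n.+1 -> K) a b :
  (val G).@[fun i => a * v i + b * w i] = a * (val G).@[v] + b * (val G).@[w].
Proof.
rewrite !linear_form_eval !mulr_sumr -big_split; apply: eq_bigr => i _ /=; ring.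
Qed.

Lemma rmorphism_congr I (f g : {rmorphism R -> R}) : is_ideal I ->
  (forall c, f c%:MP = g c%:MP) -> (forall i, I (f 'X_i - g 'X_i)) ->
  forall p, I (f p - g p).
Proof.
move=> idI fgC fgX p; rewrite (mpolyE p) !rmorph_sum -sumrB.
apply: (ideal_sum idI) => a _; rewrite -mul_mpolyC !rmorphM fgC -mulrBr.
apply: (ideal_mull idI); rewrite mpolyXE_id !rmorph_prod.
have congrM x y x' y' : I (x - y) -> I (x' - y') -> I (x * x' - y * y').
  move=> Ixy Ixy'; rewrite (_ : _ - _ = x' * (x - y) + y * (x' - y')); last by ring.
  by apply: (ideal_add idI); apply: (ideal_mull idI).
have I0 x : I (x - x) by rewrite subrr; apply: ideal_zero.
apply: (big_rec2 (fun x y => I (x - y))) => [//|i x y _ Ixy].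
apply: (congrM _ _ _ _) => //; rewrite !rmorphXn; elim: (a i) => [|k IHk]; first by rewrite !expr0.
by rewrite !exprS; apply: congrM.
Qed.

(* The retraction sigma onto the hyperplane G = 0 along a coordinate axis has
   kernel (G), and sigma F does not vanish at the point q. *)
Lemma linear_form_dvd (G : form 1) (F u h : R) (q : 'I_n.+1 -> K) :
  (val G).@[q] = 0 -> F.@[q] != 0 -> val G * u = h * F -> G != 0 ->
  exists h', h = val G * h'.
Proof.
move=> Gq Fq GuhF G0.
have [j gj] : exists j, (val G)@_U_(j) != 0.
  apply: NNPP => noj; case/eqP: G0; apply/val_inj; rewrite /= linear_formE big1 // => i _.
  apply/eqP; rewrite scaler_eq0; apply/orP; left; apply/negPn/negP => gi.
  by apply: noj; exists i.
set c := (val G)@_U_(j) in gj.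
pose s (i : 'I_n.+1) : R := 'X_i - (i == j)%:R * c^-1 *: val G.
pose sigma : R -> R := mmap (@mpolyC n.+1 K) s.
have sX i : sigma 'X_i = s i by rewrite /sigma mmapX mmap1U.
have sC a : sigma a%:MP = a%:MP by rewrite /sigma mmapC.
have sF : sigma F != 0.
  apply: contraNneq Fq => sF0.
  have -> : F.@[q] = (sigma F).@[q].
    rewrite -[RHS]/((meval q \o mmap (@mpolyC n.+1 K) s) F).
    apply: mpoly_rmorphism_ext => [a|i] /=; first by rewrite mmapC.
    by rewrite mmapX mmap1U mevalB mevalZ Gq mulr0 subr0.
  by rewrite sF0 meval0.
have sG : sigma (val G) = 0.
  rewrite {1}linear_formE /sigma raddf_sum /=.
  under eq_bigr => i _ do
    rewrite -mul_mpolyC rmorphM /= -/(sigma _) -/(sigma _) sC sX mul_mpolyC /s scalerBr.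
  rewrite sumrB -linear_formE (bigD1 j) //= big1 => [|i ij]; last first.
    by rewrite (negPf ij) mul0r scale0r scaler0.
  by rewrite eqxx mul1r scalerA mulfV // scale1r addr0 subrr.
have sh : sigma h = 0.
  have sM x y : sigma (x * y) = sigma x * sigma y by rewrite /sigma rmorphM.
  apply/eqP; move: (congr1 sigma GuhF); rewrite !sM sG mul0r.
  by move=> /esym/eqP; rewrite mulf_eq0 (negPf sF) orbF.
have [||_ -> [h' hE]] := @rmorphism_congr (add_gen (@zero_ideal R) (val G)) idfun
    (mmap (@mpolyC n.+1 K) s) (add_gen_ideal zero_idealP _) _ _ h.
- by move=> a; rewrite /= mmapC.
- move=> i; exists 0 => //; exists (((i == j)%:R * c^-1)%:MP).
  by rewrite /= mmapX mmap1U /s opprB addrC subrK add0r mul_mpolyC.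
- by exists h'; move: hE; rewrite /= -/(sigma h) sh subr0 add0r mulrC.
Qed.

Lemma general_form_sub a (P Q : form a -> Prop) :
  (forall G, P G -> Q G) -> general_form P -> general_form Q.
Proof. by move=> PQ [Phi Phi0 PhiP]; exists Phi => // G /PhiP /PQ. Qed.

Lemma general_linear_form (F : R) : (forall s : seq K, exists x, x \notin s) ->
  (1 <= n)%N -> F != 0 ->
  general_form (fun G : form 1 =>
    G != 0 /\ exists2 q : 'I_n.+1 -> K, (val G).@[q] = 0 & F.@[q] != 0).
Proof.
move=> infK n1 F0; have [p Fp] := nonvanishing_point infK F0.
have [e [G0 [G0p G0e]]] : exists (e : 'I_n.+1 -> K) (G : form 1),
    (val G).@[p] = 0 /\ (val G).@[e] = 1.
  have [[i pi0]|p0] := classic (exists i, p i != 0).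
    have [j ji] : exists j, j != i.
      have [->|] := eqVneq i ord0; last by rewrite eq_sym; exists ord0.
      by exists (Ordinal (n1 : (1 < n.+1)%N)).
    exists (fun k => (k == j)%:R), (var_form j - (p j / p i) *: var_form i).
    rewrite raddfB linearZ /= !mevalB !mevalZ !mevalXU eqxx (negPf (_ : i != j)) ?mulr0 ?subr0.
      by rewrite divfK // subrr.
    by rewrite eq_sym.
  exists (fun k => (k == ord0)%:R), (var_form ord0); rewrite /= !mevalXU eqxx; split=> //.
  by apply/eqP/negPn/negP => p0'; apply: p0; exists ord0.
set B := vbasis {:form 1}.
pose L (v : 'I_n.+1 -> K) : {mpoly K[\dim {:form 1}]} :=
  \sum_(k < \dim {:form 1}) (val B`_k).@[v] *: 'X_k.
have LE v (G : form 1) : (L v).@[fun i => coord B i G] = (val G).@[v].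
  rewrite [in RHS](coord_vbasis (memvf G)) !raddf_sum /=; apply: eq_bigr => k _.
  by rewrite linearZ /= !mevalZ mevalXU mulrC.
pose Q := [tuple p i *: L e - e i *: L p | i < n.+1].
exists (L e * (F \mPo Q)).
  have : (L e * (F \mPo Q)).@[fun i => coord B i G0] != 0.
    rewrite mevalM LE G0e mul1r comp_mpoly_meval.
    rewrite (meval_eq (v2 := p)) // => i.
    by rewrite tnth_mktuple mevalB !mevalZ !LE G0e G0p mulr1 mulr0 subr0.
  by apply: contraNneq => ->; rewrite meval0.
move=> G; rewrite mevalM LE comp_mpoly_meval mulf_eq0 negb_or => /andP[Ge Fq].
split; first by apply: contraNneq Ge => ->; rewrite /= !raddf0.
exists (fun i => (val G).@[e] * p i + (- (val G).@[p]) * e i).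
  by rewrite linear_form_evalD; ring.
apply: contraNneq Fq => <-; apply/eqP/meval_eq => i.
by rewrite tnth_mktuple mevalB !mevalZ !LE; ring.
Qed.

End LinearForms.

(** * Numerators of Hilbert series *)

Lemma diff_polyMX (g : nat -> int) (p : {poly int}) :
  (forall t, g t = p`_t) -> forall t, diff g t = ((1 - 'X) * p)`_t.
Proof.
move=> gp t; rewrite /diff mulrBl mul1r coefB coefXM gp.
by case: t => //= t; rewrite gp.
Qed.

Lemma shift_polyMX (g : nat -> int) (p : {poly int}) :
  (forall t, g t = p`_t) -> forall t, shift 1 g t = ('X * p)`_t.
Proof. by move=> gp [|t]; rewrite /shift coefXM //= subn1 gp. Qed.

Lemma poly_of_finsupp (g : nat -> int) : finsupp_fun g ->
  exists p : {poly int}, forall t, g t = p`_t.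
Proof.
move=> [B gB]; exists (\poly_(i < B) g i) => t.
by rewrite coef_poly; case: ltnP => // /gB.
Qed.

Lemma diff_binomial j t :
  diff (fun t => ('C(t + j.+1, j.+1))%:Z) t = ('C(t + j, j))%:Z.
Proof.
rewrite /diff; case: t => [|t]; first by rewrite !add0n !binn subr0.
by rewrite addSn binS PoszD addrAC subrr add0r addSnnS.
Qed.

Lemma iter_diff_binomial j t : iter j diff (fun t => ('C(t + j, j))%:Z) t = 1.
Proof.
elim: j t => [|j IHj] t; first by rewrite /= bin0.
by rewrite iterSr -(IHj t); apply: eq_iter_diff => s; apply: diff_binomial.
Qed.

Lemma iter_diff_inj k g h : iter k diff g =1 iter k diff h -> g =1 h.
Proof.
have diff_inj (g' h' : nat -> int) : diff g' =1 diff h' -> g' =1 h'.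
  move=> gh; elim=> [|t IHt]; first by have := gh 0%N; rewrite /diff !subr0.
  by have := gh t.+1; rewrite /diff IHt => /addIr.
by elim: k => [//|k IHk] /diff_inj.
Qed.

Section DoubleLink.
Context {K : fieldType} {n : nat}.
Local Notation R := {mpoly K[n.+1]}.
Local Notation form := (dhomog n.+1 K).
Implicit Types (I J : R -> Prop) (f g h : R).

(* The Hilbert series of R/I is p(T) / (1 - T)^n. *)
Definition numerator I (p : {poly int}) : Prop :=
  forall t, iter n diff (hilbz I) t = p`_t.

Lemma numerator_hilb I J p t : numerator I p -> numerator J p -> hilb I t = hilb J t.
Proof.
move=> Ip Jp; suff /(_ t)[] : hilbz I =1 hilbz J by [].
by apply: (@iter_diff_inj n) => s; rewrite Ip Jp.
Qed.

Lemma iter_diff_hilbz_zero t : iter n diff (hilbz (@zero_ideal R)) t = 1.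
Proof.
rewrite -[RHS](iter_diff_binomial n t); apply: eq_iter_diff => s; congr (Posz _).
have := @hilbE K n (@zero_ideal R) s 0%VS _; rewrite dimv0 add0n => ->.
  rewrite dimvf; transitivity 'C(s + n, s); first by [].
  by rewrite -[RHS]bin_sub ?leq_addl // addnK.
by move=> f; rewrite memv0; split=> [/eqP->|f0]; [|apply/eqP/val_inj].
Qed.

Lemma zero_homogeneous : homogeneous_ideal (@zero_ideal R).
Proof. by split; [apply: zero_idealP | move=> d f ->; rewrite /zero_ideal raddf0]. Qed.

Lemma regular_mod_zero f : f != 0 -> regular_mod (@zero_ideal R) f.
Proof. by move=> f0 g /eqP; rewrite mulf_eq0 (negPf f0) => /eqP. Qed.

Lemma double_link_ideal I F G : is_ideal I -> is_ideal (double_link I F G).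
Proof.
move=> idI; split.
- by exists 0; [apply: ideal_zero | exists 0; rewrite mulr0 mul0r addr0].
- move=> _ _ [u Iu [h ->]] [u' Iu' [h' ->]]; exists (u + u'); first exact: ideal_add.
  by exists (h + h'); ring.
- move=> f _ [u Iu [h ->]]; exists (f * u); first exact: ideal_mull.
  by exists (f * h); ring.
Qed.

Lemma double_link_homogeneous I d (F : form d) e (G : form e) : homogeneous_ideal I ->
  homogeneous_ideal (double_link I (val F) (val G)).
Proof.
move=> [idI homI]; have idJ := double_link_ideal (val F) (val G) idI; split=> // t f.
move=> [u Iu [h ->]]; rewrite raddfD /= (mulrC (val G) u); apply: (ideal_add idJ).
  have [te|et] := ltnP t e.
    by rewrite (pihomogM_homog_lt _ (dhomog_is_dhomog G)) //; apply: ideal_zero.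
  rewrite -(subnK et) (pihomogM_homog _ _ (dhomog_is_dhomog G)).
  by exists (pihomog mdeg (t - e) u); [apply: homI | exists 0; rewrite mulrC mul0r addr0].
have [td|dt] := ltnP t d.
  by rewrite (pihomogM_homog_lt _ (dhomog_is_dhomog F)) //; apply: ideal_zero.
rewrite -(subnK dt) (pihomogM_homog _ _ (dhomog_is_dhomog F)).
exists 0; first exact: ideal_zero.
by exists (pihomog mdeg (t - d) h); rewrite mulr0 add0r.
Qed.

Lemma double_link_mem I F G : is_ideal I -> double_link I F G F.
Proof. by move=> idI; exists 0; [apply: ideal_zero | exists 1; rewrite mulr0 add0r mul1r]. Qed.

Lemma hilbz_eq_ideal I J : is_ideal I -> (forall f, I f <-> J f) -> hilbz I =1 hilbz J.
Proof. by move=> idI IJ t; congr (Posz _); apply: eq_hilb. Qed.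

(* For J = G I + (F) with F and G coprime, J : G = I and J + (G) = (F, G) is a
   complete intersection. *)
Lemma numerator_double_link I p d (F : form d) (G : form 1) :
  homogeneous_ideal I -> numerator I p -> I (val F) -> F != 0 -> G != 0 ->
  (forall u h, val G * u = h * val F -> exists h', h = val G * h') ->
  numerator (double_link I (val F) (val G)) ('X * p + 1 - 'X^d).
Proof.
move=> homI Ip IF F0 G0 coprimeFG t; have [idI _] := homI.
set J := double_link _ _ _; pose FI := add_gen (@zero_ideal R) (val F).
have homJ : homogeneous_ideal J := double_link_homogeneous F G homI.
have homFI : homogeneous_ideal FI := add_gen_homogeneous F zero_homogeneous.
have [idJ _] := homJ; have [idFI _] := homFI.
have F0' : val F != 0 by apply: contraNneq F0 => F0; apply/eqP/val_inj.
have G0' : val G != 0 by apply: contraNneq G0 => G0; apply/eqP/val_inj.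
have colonJ f : colon J (val G) f <-> I f.
  split=> [[u Iu [h GfE]]|If]; last by exists f => //; exists 0; rewrite mul0r addr0.
  have [|h' hE] := coprimeFG (f - u) h; first by rewrite mulrBr GfE addrC addKr.
  have -> : f = u + h' * val F.
    by apply: (mulfI G0'); rewrite mulrDr mulrA -hE.
  by apply: ideal_add => //; apply: ideal_mull.
have JG f : add_gen J (val G) f <-> add_gen FI (val G) f.
  split=> [[_ [u Iu [h ->]] [h' ->]]|[_ [_ -> [h ->]] [h' ->]]].
    exists (h * val F); last by exists (u + h'); ring.
    by exists 0 => //; exists h; rewrite add0r.
  exists (h * val F); last by exists h'; rewrite add0r.
  by exists 0; [apply: ideal_zero | exists h; rewrite mulr0 add0r].
have regG : regular_mod FI (val G).
  move=> f [_ -> [h]]; rewrite add0r => /[dup] GfE /coprimeFG[h' hE].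
  exists 0 => //; exists h'; rewrite add0r; apply: (mulfI G0').
  by rewrite GfE hE mulrA.
have zero_num s : iter n diff (hilbz FI) s = (s < d)%:R.
  rewrite (eq_iter_diff n (h := fun t => hilbz (@zero_ideal R) t +
    - shift d (hilbz (@zero_ideal R)) t)); last first.
    by move=> r; rewrite /FI (hilbz_regular _ zero_homogeneous (regular_mod_zero F0')).
  have iterN k (g : nat -> int) r : iter k diff (fun t => - g t) r = - iter k diff g r.
    elim: k r => //= k IHk [|r]; rewrite /diff !IHk ?subr0 //.
    by rewrite opprB addrC opprK.
  rewrite iter_diffD iterN iter_diff_shift iter_diff_hilbz_zero /shift.
  by case: ltnP => _; rewrite ?subr0 // iter_diff_hilbz_zero subrr.
have iter_shift1 (g : nat -> int) (q : {poly int}) s : (forall r, iter n diff g r = q`_r) ->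
    iter n diff (shift 1 g) s = ('X * q)`_s.
  by move=> gq; rewrite iter_diff_shift; apply: shift_polyMX.
rewrite (eq_iter_diff n (h := fun t => shift 1 (hilbz I) t + diff (hilbz FI) t)); last first.
  move=> s; rewrite (hilbz_exact G _ homJ); congr (_ + _).
    rewrite /shift; case: ifP => // _; apply: hilbz_eq_ideal => //; exact: colon_ideal.
  rewrite (hilbz_eq_ideal _ JG); last exact: add_gen_ideal.
  rewrite (hilbz_regular _ homFI regG) /diff /shift.
  by case: s => [|s]; rewrite ?subn1.
rewrite iter_diffD (iter_shift1 _ _ _ Ip) -iterSr iterS.
set g := iter n diff (hilbz FI) in zero_num *; rewrite /diff !zero_num.
rewrite coefB coefD coefXn coef1 -addrA; congr (_ + _); case: t => [|t].
  by rewrite subr0 lt0n eq_sym; case: eqP.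
by rewrite zero_num; case: (ltngtP t.+1 d).
Qed.

Definition link_numerator (ds : seq nat) (p : {poly int}) : {poly int} :=
  foldl (fun q d => 'X * q + 1 - 'X^d) p ds.

Lemma form_multiple d e (F : form d) : (d <= e)%N -> F != 0 ->
  exists2 F' : form e, F' != 0 & exists h, val F' = h * val F.
Proof.
move=> de F0; pose h : R := 'X_ord0 ^+ (e - d).
have h_hom : h * val F \is e.-homog.
  have : h * val F \is (1 * (e - d) + d).-homog.
    by apply: dhomogM (dhomog_is_dhomog F); apply/dhomogMn/(dhomog_is_dhomog (var_form ord0)).
  by rewrite mul1n subnK.
exists (DHomog h_hom); last by exists h.
apply: contraNneq F0 => /(congr1 val)/=/eqP; rewrite mulf_eq0 expf_eq0 => /orP[|/eqP F0].
  by rewrite -msize_poly_eq0 msizeX andbF.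
exact/eqP/val_inj.
Qed.

Lemma basic_double_links_of_degrees (infK : forall s : seq K, exists x, x \notin s)
    (n1 : (1 <= n)%N) (prop : (R -> Prop) -> Prop) ds I p d0 (F0 : form d0) :
  homogeneous_ideal I -> numerator I p -> I (val F0) -> F0 != 0 -> path leq d0 ds ->
  (forall J, homogeneous_ideal J -> numerator J (link_numerator ds p) -> prop J) ->
  basic_double_links [seq (d, 1%N) | d <- ds] prop I.
Proof.
elim: ds I p d0 F0 => [|d ds IHds] I p d0 F0 homI Ip IF0 F00 /=; first by move=> _; apply.
move=> /andP[d0d path_ds] propJ; have [idI _] := homI.
have [F Fn0 [h FE]] := form_multiple d0d F00.
have IF : I (val F) by rewrite FE; apply: ideal_mull.
have F0' : val F != 0 by apply: contraNneq Fn0 => F0'; apply/eqP/val_inj.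
exists F; split=> //; apply: general_form_sub (general_linear_form infK n1 F0').
move=> G [G0 [q Gq Fq]]; apply: (IHds _ ('X * p + 1 - 'X^d) d F) => //.
- exact: double_link_homogeneous.
- apply: numerator_double_link => // u h' GuhF.
  exact: (linear_form_dvd Gq Fq GuhF G0).
- exact: double_link_mem.
Qed.

End DoubleLink.

(* The degrees d_j = j + k + s_j, for j = 1, 2, .. *)
Fixpoint degrees_from (k : nat) (s : seq nat) : seq nat :=
  if s is a :: s' then (a + k.+1)%N :: degrees_from k.+1 s' else [::].

Lemma link_numerator_degrees k s p :
  link_numerator (degrees_from k s) p =
  'X^(size s) * p + \sum_(i < size s) 'X^i - 'X^(size s + k) * \sum_(a <- s) 'X^a.
Proof.
elim: s k p => [|a s IHs] k p /=.
  by rewrite big_ord0 big_nil expr0 mul1r mulr0 subr0 addr0.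
rewrite -/(link_numerator _ _) IHs big_ord_recr big_cons /=.
rewrite (_ : a + k.+1 = (k + a).+1)%N; last by lia.
by rewrite addnS addSn !exprS !exprD; ring.
Qed.

Lemma path_degrees k s a : path (fun a b => a <= b.+1)%N a s ->
  path leq (a + k)%N (degrees_from k s).
Proof.
elim: s k a => [//|b s IHs] k a /= /andP[ab /IHs path_s]; apply/andP; split; last exact: path_s.
by rewrite addnS -addSn leq_add2r.
Qed.

Lemma path_descent D s : sorted leq s -> path (fun a b => a <= b.+1)%N D (rev (iota 0 D) ++ s).
Proof.
move=> sorted_s; elim: D => [|D IHD].
  have : path leq 0%N s by case: s sorted_s.
  by apply: sub_path => a b /leqW.
by rewrite -addn1 iotaD rev_cat /= add0n addn1 leqnn.
Qed.

Lemma one_minus_X_mul (k : {poly int}) : exists A B : seq nat,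
  size A = size B /\ (1 - 'X) * k = \sum_(a <- A) 'X^a - \sum_(b <- B) 'X^b.
Proof.
elim/poly_ind: k => [|k c [A [B [sAB kE]]]].
  by exists [::], [::]; rewrite mulr0 !big_nil subr0.
have sum_succ s : \sum_(a <- map S s) 'X^a = 'X * \sum_(a <- s) 'X^a :> {poly int}.
  by rewrite big_map mulr_sumr; apply: eq_bigr => a _; rewrite exprS.
have sum_nseq N a : \sum_(b <- nseq N a) 'X^b = 'X^a *+ N :> {poly int}.
  by rewrite big_nseq iter_addr addr0.
have [N cE] : exists N : nat, c%:P = 1 *+ N :> {poly int} \/ c%:P = - (1 *+ N) :> {poly int}.
  case: c => N; first by exists N; left; rewrite -natz rmorph_nat.
  by exists N.+1; right; rewrite NegzE rmorphN -natz rmorph_nat.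
have sum_eq A' B' : \sum_(a <- map S A ++ A') 'X^a - \sum_(b <- map S B ++ B') 'X^b =
    (1 - 'X) * (k * 'X) + (\sum_(a <- A') 'X^a - \sum_(b <- B') 'X^b) :> {poly int}.
  by rewrite !big_cat !sum_succ mulrA kE /=; ring.
case: cE => cE.
  exists (map S A ++ nseq N 0%N), (map S B ++ nseq N 1%N).
  rewrite !size_cat !size_map !size_nseq sAB; split=> //.
  by rewrite sum_eq !sum_nseq cE expr0 expr1 mulrDr; congr (_ + _); ring.
exists (map S A ++ nseq N 1%N), (map S B ++ nseq N 0%N).
rewrite !size_cat !size_map !size_nseq sAB; split=> //.
by rewrite sum_eq !sum_nseq cE expr0 expr1 mulrDr; congr (_ + _); ring.
Qed.

Definition descent_degrees (D : nat) (A : seq nat) : seq nat :=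
  degrees_from 0 (rev (iota 0 D) ++ sort leq A).

Lemma path_descent_degrees d D A : (d <= D)%N -> path leq d (descent_degrees D A).
Proof.
move=> dD; apply: (path_le leq_trans (x' := (D + 0)%N)); first by rewrite addn0.
exact/path_degrees/path_descent/sort_sorted/leq_total.
Qed.

Lemma link_numerator_descent D A B p : size A = size B ->
  p = \sum_(a <- A) 'X^a - \sum_(b <- B) 'X^b ->
  link_numerator (descent_degrees D A) p = link_numerator (descent_degrees D B) 0.
Proof.
move=> sAB ->; rewrite !link_numerator_degrees !size_cat !size_sort sAB addn0 mulr0 add0r.
rewrite !big_cat /= !(perm_big _ (permEl (perm_sort leq _))) /=; ring.
Qed.

(** * Extensions of Artinian ideals in two variables *)

Lemma kernel_prime (R : comNzRingType) (S : idomainType) (phi : {rmorphism R -> S}) :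
  is_prime (fun f => phi f = 0).
Proof.
split; first split=> [|f g f0 g0|f g g0].
- exact: rmorph0.
- by rewrite rmorphD f0 g0 addr0.
- by rewrite rmorphM g0 mulr0.
- by rewrite rmorph1 => /eqP; rewrite oner_eq0.
- by move=> f g /eqP; rewrite rmorphM mulf_eq0 => /orP[/eqP|/eqP]; [left | right].
Qed.

Lemma zero_ideal_prime (R : idomainType) : is_prime (@zero_ideal R).
Proof. exact: (kernel_prime idfun). Qed.

Section FreedVariables.
Context {K : fieldType} {m : nat}.
Local Notation R := {mpoly K[m]}.
Implicit Types (E I M P : R -> Prop) (f g : R) (i j : 'I_m) (zs : seq 'I_m).

Definition free_vars zs M : R -> Prop := foldr free_var M zs.

Lemma free_vars_prime zs M : is_prime M -> is_prime (free_vars zs M).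
Proof. by move=> primeM; elim: zs => [//|i zs IHzs]; apply: free_var_prime. Qed.

Lemma free_vars_extended zs E M : subideal E M -> (forall i, i \in zs -> extended i E) ->
  subideal E (free_vars zs M).
Proof.
move=> EM; elim: zs => [//|i zs IHzs] extE f Ef /= k.
apply: IHzs; first by move=> j jzs; apply: extE; rewrite inE jzs orbT.
by apply: extE => //; rewrite mem_head.
Qed.

Lemma free_vars_poly_var zs M i p : is_ideal M -> i \notin zs -> M (poly_var i p) ->
  free_vars zs M (poly_var i p).
Proof.
move=> idM + Mp; elim: zs => [//|j zs IHzs] /=; rewrite inE negb_or => /andP[ij izs] k.
rewrite split_var_poly_var_neq // coefC.
have idQ : is_ideal (free_vars zs M) by elim: (zs) => [//|l s IHs]; apply: free_var_ideal.
by case: eqP => _; [apply: IHzs | apply: ideal_zero].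
Qed.

Lemma height_ge_free_vars zs I M : is_prime M -> uniq zs ->
  (forall i, i \in zs -> exists2 p, p \is monic & M (poly_var i p)) ->
  subideal I (free_vars zs M) -> height_ge I M (size zs).
Proof.
move=> primeM uzs algM IQ; exists (fun j : nat => free_vars (drop j zs) M).
split; rewrite ?drop0 ?drop_size //; first by move=> j _; apply: free_vars_prime.
move=> j jzs; case: zs => [//|z0 zs'] in uzs algM IQ jzs *.
set zs := z0 :: zs' in uzs algM IQ jzs *.
rewrite (drop_nth z0 jzs) /=; set i := nth z0 zs j; set Q := free_vars (drop j.+1 zs) M.
have [idQ Q1 _] : is_prime Q by apply: free_vars_prime.
split; first exact: free_var_sub.
have [p monp Mp] := algM i (mem_nth _ jzs); have [idM _ _] := primeM.
have Qp : Q (poly_var i p).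
  apply: free_vars_poly_var => //.
  have := drop_uniq j uzs; rewrite (drop_nth z0 jzs) /= => /andP[].
  by [].
move=> /(_ _ Qp (size p).-1); rewrite split_var_poly_var coef_map /= -lead_coefE.
by rewrite (monicP monp) mpolyC1.
Qed.

Lemma depth_ge_monic_vars zs E M : is_ideal E -> is_ideal M -> ~ M 1 -> uniq zs ->
  (forall i, i \in zs -> exists2 p, p \is monic & M (poly_var i p)) ->
  subideal E M -> (forall i, i \in zs -> extended i E) -> depth_ge E M (size zs).
Proof.
move=> idE idM M1; elim: zs E idE => [|i zs IHzs] E idE /=.
  by move=> _ _ EM _; exists [::]; split=> //= /EM.
move=> /andP[izs uzs] algM EM extE.
have [p monp Mp] := algM i (mem_head _ _).
have [|||s [szs Ms regs]] := IHzs (add_gen E (poly_var i p)) (add_gen_ideal idE _) uzs.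
- by move=> j jzs; apply: algM; rewrite inE jzs orbT.
- exact: add_gen_min.
- move=> j jzs; apply: extended_add_gen => //; first by apply: extE; rewrite inE jzs orbT.
  by apply: split_var_poly_var_neq; apply: contraNneq izs => ->.
exists (poly_var i p :: s); split=> /=; first by rewrite szs.
  by move=> f; rewrite inE => /orP[/eqP->|/Ms].
split=> // g; apply: extended_regular => //.
by apply: extE; rewrite mem_head.
Qed.

Lemma poly_varXn i k : poly_var i 'X^k = 'X_i ^+ k :> R.
Proof. by rewrite rmorphXn /= poly_varX. Qed.

End FreedVariables.

Section Staircase.
Context {K : fieldType} {n : nat}.
Local Notation R := {mpoly K[n.+1]}.
Local Notation form := (dhomog n.+1 K).
Hypothesis n2 : (2 <= n)%N.
Implicit Types (E I P : R -> Prop) (f g h : R).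

Let x0 : 'I_n.+1 := ord0.
Let x1 : 'I_n.+1 := inord 1.

Lemma staircase_vars_neq : x1 != x0.
Proof. by rewrite -val_eqE /= inordK // ltnS ltnW. Qed.

Definition other_vars : seq 'I_n.+1 := [seq i <- enum 'I_n.+1 | (i != x0) && (i != x1)].

Lemma mem_other_vars i : (i \in other_vars) = (i != x0) && (i != x1).
Proof. by rewrite mem_filter mem_enum andbT. Qed.

Lemma uniq_other_vars : uniq other_vars.
Proof. exact/filter_uniq/enum_uniq. Qed.

Lemma size_other_vars : size other_vars = n.-1.
Proof.
have := cardC (pred2 x0 x1); rewrite card2 eq_sym staircase_vars_neq card_ord.
rewrite -(card_uniqP uniq_other_vars) => nE.
rewrite (eq_card (B := [predC pred2 x0 x1])) => [|i]; first by case: nE => /(congr1 predn).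
by rewrite mem_other_vars !inE negb_or.
Qed.

(* For E the unit ideal, the extension to R of the monomial ideal of
   K[x_0, x_1] whose staircase has rows of length d, for d in ds. *)
Definition staircase (ds : seq nat) E : R -> Prop :=
  foldl (fun E d => double_link E ('X_x1 ^+ d) 'X_x0) E ds.

Lemma var_pow_proof d : ('X_x1 ^+ d : R) \is d.-homog.
Proof. by rewrite -[d in d.-homog]mul1n; apply/dhomogMn/(dhomog_is_dhomog (var_form x1)). Qed.

Lemma staircase_step E p d : homogeneous_ideal E -> numerator E p -> E ('X_x1 ^+ d) ->
  homogeneous_ideal (double_link E ('X_x1 ^+ d) 'X_x0) /\
  numerator (double_link E ('X_x1 ^+ d) 'X_x0) ('X * p + 1 - 'X^d).
Proof.
move=> homE Ep Ed; pose F : form d := DHomog (var_pow_proof d); pose G : form 1 := var_form x0.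
have evF (q : 'I_n.+1 -> K) : q x1 != 0 -> (val F).@[q] != 0.
  by move=> q1; rewrite /= rmorphXn /= mevalXU expf_neq0.
split; first exact: (double_link_homogeneous F G homE).
apply: (@numerator_double_link _ _ E p d F G) => //.
- apply: contraTneq (evF (fun=> 1) (oner_neq0 _)) => ->.
  by rewrite /= raddf0 eqxx.
- apply: contraTneq (oner_neq0 K) => /(congr1 (fun G => (val G).@[fun=> 1])).
  by rewrite /= mevalXU raddf0 => ->; rewrite eqxx.
move=> u h GuhF.
apply: (@linear_form_dvd _ _ G (val F) u h (fun i => (i == x1)%:R) _ _ GuhF).
- by rewrite /= mevalXU eq_sym (negPf staircase_vars_neq).
- by apply: evF; rewrite eqxx oner_neq0.
- apply: contraTneq (oner_neq0 K) => /(congr1 (fun G => (val G).@[fun=> 1])).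
  by rewrite /= mevalXU raddf0 => ->; rewrite eqxx.
Qed.

Lemma extended_double_link i E d : is_ideal E -> extended i E -> i != x0 -> i != x1 ->
  extended i (double_link E ('X_x1 ^+ d) 'X_x0).
Proof.
move=> idE extE i0 i1 _ [u Eu [h ->]] k.
rewrite rmorphD !rmorphM rmorphXn /= !split_varX_neq 1?eq_sym // -polyC_exp coefD coefCM coefMC.
by exists (split_var i u)`_k; [apply: extE | exists (split_var i h)`_k].
Qed.

Lemma staircaseP ds E p d a : homogeneous_ideal E -> numerator E p ->
  (forall i, i != x0 -> i != x1 -> extended i E) ->
  E ('X_x0 ^+ a) -> E ('X_x1 ^+ d) -> path leq d ds ->
  [/\ homogeneous_ideal (staircase ds E), numerator (staircase ds E) (link_numerator ds p),
      forall i, i != x0 -> i != x1 -> extended i (staircase ds E) &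
      exists a b, staircase ds E ('X_x0 ^+ a) /\ staircase ds E ('X_x1 ^+ b)].
Proof.
elim: ds E p d a => [|d' ds IHds] E p d a homE Ep extE Ea Ed /=.
  by move=> _; split=> //; exists a, d.
move=> /andP[dd' path_ds]; have [idE _] := homE.
have Ed' : E ('X_x1 ^+ d') by rewrite -(subnK dd') exprD; apply: ideal_mull.
have [homE' E'p] := staircase_step homE Ep Ed'.
apply: (IHds _ _ d' a.+1) => //; last exact: double_link_mem.
- by move=> i i0 i1; apply: extended_double_link => //; apply: extE.
- by exists ('X_x0 ^+ a) => //; exists 0; rewrite mul0r addr0 exprS.
Qed.

Lemma staircase_sub ds E P : is_ideal P -> P 'X_x0 -> P 'X_x1 -> ds != [::] ->
  (forall d, d \in ds -> (0 < d)%N) -> subideal (staircase ds E) P.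
Proof.
move=> idP P0 P1; case/lastP: ds => [//|ds d] _ ds0 f.
rewrite /staircase foldl_rcons => -[u _ [h ->]].
have /prednK <- : (0 < d)%N by apply: ds0; rewrite mem_rcons mem_head.
rewrite exprS; apply: (ideal_add idP); first exact: (ideal_mulr idP).
by apply: (ideal_mull idP); apply: (ideal_mulr idP).
Qed.

Definition multiple_of_x0 f : Prop := (split_var x0 f).[0] = 0.

Lemma multiple_of_x0_prime : is_prime multiple_of_x0.
Proof. exact: (kernel_prime (horner_eval 0 \o split_var x0)). Qed.

Lemma multiple_of_x0_sub P : is_ideal P -> P 'X_x0 -> subideal multiple_of_x0 P.
Proof.
move=> idP P0 f; rewrite /multiple_of_x0 horner_coef0 => f0.
rewrite -(split_varK x0 f) horner_coef; apply: (ideal_sum idP) => -[k /= _] _.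
case: k => [|k]; first by rewrite f0 mul0r; apply: ideal_zero.
by rewrite exprS; apply: (ideal_mull idP); apply: (ideal_mulr idP).
Qed.

Section ExtendedArtinian.
Variables (E : R -> Prop) (a b : nat).
Hypothesis homE : homogeneous_ideal E.
Hypothesis extE : forall i, i \in other_vars -> extended i E.
Hypotheses (Ea : E ('X_x0 ^+ a)) (Eb : E ('X_x1 ^+ b)).
Hypothesis E_sub : forall P, is_ideal P -> P 'X_x0 -> P 'X_x1 -> subideal E P.

Let idE : is_ideal E. Proof. by case: homE. Qed.

Lemma growth_le_artinian : growth_le E n.-1.
Proof.
pose A := add_gen (@zero_ideal R) ('X_x0 ^+ a).
have idA : is_ideal A := add_gen_ideal zero_idealP _.
have X0 : 'X_x0 != 0 :> R by rewrite -msize_poly_eq0 msizeX.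
have gA : growth_le A n.
  apply: (growth_le_regular zero_idealP idA (f := 'X_x0 ^+ a) _ _ _ growth_le_zero).
  - exact/regular_mod_zero/expf_neq0.
  - exact: add_gen_sub.
  - exact/add_gen_mem/zero_idealP.
pose B := add_gen A ('X_x1 ^+ b); have idB : is_ideal B := add_gen_ideal idA _.
have extA : extended x1 A.
  apply: extended_add_gen => //; first exact: zero_idealP.
    by move=> f -> k; rewrite rmorph0 coef0.
  by rewrite rmorphXn /= split_varX_neq 1?eq_sym ?staircase_vars_neq // polyC_exp.
have gB : growth_le B n.-1.
  apply: (growth_le_regular idA idB (f := 'X_x1 ^+ b)) => //.
  - move=> g; rewrite -poly_varXn; apply: extended_regular => //.
    exact: monicXn.
  - exact: add_gen_sub.
  - exact: add_gen_mem.
  - by rewrite prednK // ltnW.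
apply: growth_le_sub gB; apply: add_gen_min => //; apply: add_gen_min => //.
by move=> f ->; apply: ideal_zero.
Qed.

Lemma saturated_artinian : saturated E.
Proof.
move=> f [k Ek]; have : (0 < size other_vars)%N by rewrite size_other_vars; move: n2; clear; lia.
case zsE: other_vars => [//|z zs] _.
have zother : z \in other_vars by rewrite zsE mem_head.
have z_hom : ('X_z ^+ k : R) \is k.-homog.
  by rewrite -[k in k.-homog]mul1n; apply/dhomogMn/(dhomog_is_dhomog (var_form z)).
apply: (extended_regular idE (extE zother) (monicXn _ k)).
by rewrite poly_varXn mulrC; apply: (Ek (DHomog z_hom)).
Qed.

Lemma codim_artinian : codim_eq E 2.
Proof.
split=> [P primeP EP|codim3].
  have [idP _ _] := primeP.
  have P0 : P 'X_x0 by apply: prime_expr primeP (EP _ Ea).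
  have P1 : P 'X_x1 by apply: prime_expr primeP (EP _ Eb).
  have X0 i : 'X_i != 0 :> R by rewrite -msize_poly_eq0 msizeX.
  exists (fun k => if k is k'.+1 then if k' is 0 then multiple_of_x0 else P else @zero_ideal R).
  split=> //.
  - by case=> [|[|k]] _; [exact: zero_ideal_prime | exact: multiple_of_x0_prime | exact: primeP].
  - case=> [|[|//]] _; split.
    + by move=> f ->; rewrite /multiple_of_x0 rmorph0 horner0.
    + move=> /(_ 'X_x0); rewrite /multiple_of_x0 split_varX hornerX => /(_ erefl) /eqP.
      by rewrite (negPf (X0 _)).
    + exact: multiple_of_x0_sub.
    + move=> /(_ 'X_x1 P1); rewrite /multiple_of_x0 split_varX_neq ?staircase_vars_neq // hornerC.
      by move=> /eqP; rewrite (negPf (X0 _)).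
set M := fun f : R => f.@[fun=> 0] = 0.
have primeM : is_prime M := kernel_prime (meval (fun=> 0)); have [idM _ _] := primeM.
pose P := free_vars other_vars M.
have primeP : is_prime P by apply: free_vars_prime.
have [idP _ _] := primeP.
have varP i : i \notin other_vars -> P 'X_i.
  move=> iz; rewrite -poly_varX; apply: free_vars_poly_var => //.
  by rewrite poly_varX /M mevalXU.
have EP : subideal E P by apply: E_sub => //; apply: varP; rewrite mem_other_vars eqxx ?andbF.
have [_ gP] := growth_le_height zero_idealP growth_le_zero (codim3 P primeP EP).
have heightM : height_ge P M (size other_vars).
  apply: height_ge_free_vars uniq_other_vars _ _ => // i _.
  by exists 'X; [exact: monicX | rewrite poly_varX /M mevalXU].
have [] := growth_le_height idP gP heightM.
by rewrite size_other_vars => + _; move: n2; clear; lia.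
Qed.

Lemma cohen_macaulay_artinian : cohen_macaulay_quotient E.
Proof.
move=> M maxM EM k; have primeM := maximal_prime maxM; have [idM M1 _] := primeM.
have algM (zs : seq 'I_n.+1) i : i \in zs -> exists2 p, p \is monic & M (poly_var i p).
  by move=> _; apply: nullstellensatz.
have sub_other j : {subset take j other_vars <= other_vars} by exact: mem_take.
have uniq_take j : uniq (take j other_vars) by apply/take_uniq/uniq_other_vars.
have size_k j : (j <= n.-1)%N -> j = size (take j other_vars).
  by move=> jn; rewrite size_takel // size_other_vars.
split=> [[s [<- _ regs]]|heightM].
  have le_sn := growth_le_regular_seq idE growth_le_artinian regs.
  rewrite [size s](size_k _ le_sn).
  apply: height_ge_free_vars => //; first exact: algM.
  by apply: free_vars_extended => // i /sub_other; apply: extE.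
have [le_kn _] := growth_le_height idE growth_le_artinian heightM.
rewrite [k in depth_ge _ _ k](size_k _ le_kn).
apply: depth_ge_monic_vars => //; first exact: algM.
by move=> i /sub_other; apply: extE.
Qed.

Lemma ACM_artinian : ACM_codim2 E.
Proof.
split=> //.
- exact: saturated_artinian.
- exact: codim_artinian.
- exact: cohen_macaulay_artinian.
Qed.

End ExtendedArtinian.

Lemma ACM_codim2_of_degrees ds : ds != [::] -> path leq 1%N ds ->
  exists2 IY : R -> Prop, ACM_codim2 IY & numerator IY (link_numerator ds 0).
Proof.
move=> ds0 path_ds; pose U : R -> Prop := fun=> True.
have homU : homogeneous_ideal U by [].
have numU : numerator U 0.
  move=> t; rewrite coef0 (eq_iter_diff n (h := fun=> 0)).
    by elim: (n) t => [//|k IHk] t /=; rewrite /diff IHk; case: t => [|t]; rewrite ?IHk subrr.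
  by move=> s; rewrite /hilbz hilb_all.
have [homY numY extY [a [b [Ya Yb]]]] :=
  @staircaseP ds U 0 1 0 homU numU (fun _ _ _ _ _ _ => I) I I path_ds.
exists (staircase ds U) => //; apply: (ACM_artinian homY _ Ya Yb).
  by move=> i; rewrite mem_other_vars => /andP[i0 i1]; apply: extY.
move=> P idP P0 P1; apply: staircase_sub => // d d_ds.
exact: (allP (order_path_min leq_trans path_ds)).
Qed.

End Staircase.

Lemma codim_ge2_form (K : fieldType) (n : nat) (I : {mpoly K[n.+1]} -> Prop) :
  homogeneous_ideal I -> codim_ge I 2 ->
  exists d (F : dhomog n.+1 K d), I (val F) /\ F != 0.
Proof.
move=> [idI homI] codimI; apply: NNPP => noF.
have I0 : subideal I (@zero_ideal _).
  move=> f If; apply: (homogeneousP zero_idealP) => d; apply: NNPP => fd0; apply: noF.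
  exists d, (DHomog (pihomogP mdeg d f)); split; first exact: homI.
  by apply/eqP => /(congr1 val).
have [Q [primeQ _ chainQ Q2]] := codimI _ (zero_ideal_prime _) I0.
have [Q1_sub _] := chainQ 1%N isT; have [_ []] := chainQ 0%N isT.
move=> f /Q1_sub/Q2 ->; have [idQ0 _ _] := primeQ 0%N isT.
exact: ideal_zero.
Qed.

Theorem theorem4p2 (K : fieldType) (n : nat) (I : {mpoly K[n.+1]} -> Prop)
    (K_infinite : forall s : seq K, exists x, x \notin s)
    (n_ge2 : (2 <= n)%N)
    (I_homogeneous : homogeneous_ideal I)
    (I_codim : codim_ge I 2) :
  exists types : seq (nat * nat), basic_double_links types numerically_ACM I.
Proof.
have [idI homI] := I_homogeneous.
have [d0 [F0 [IF0 F00]]] : exists d (F : dhomog n.+1 K d), I (val F) /\ F != 0.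
  exact: codim_ge2_form.
have [k kE] := poly_of_finsupp (hilbert_series_codim2 I_homogeneous I_codim).
have numI : numerator I ((1 - 'X) * k).
  by move=> t; rewrite -(diff_polyMX kE) -iterS prednK // ltnW.
have [A [B [sAB kAB]]] := one_minus_X_mul k.
pose D := d0.+1.
exists [seq (d, 1%N) | d <- descent_degrees D A].
apply: (basic_double_links_of_degrees K_infinite (ltnW n_ge2) I_homogeneous numI IF0 F00).
  by apply: path_descent_degrees; rewrite leqW.
move=> J homJ numJ; split=> //.
have [||IY acmY numY] := @ACM_codim2_of_degrees K n n_ge2 (descent_degrees D B).
- by rewrite /descent_degrees /D -addn1 iotaD rev_cat.
- exact: path_descent_degrees.
exists IY => // t; exists (hilb J t); first by apply: hilb_value; case: homJ.
have -> : hilb J t = hilb IY t.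
  apply: (numerator_hilb t numJ).
  by rewrite (link_numerator_descent _ sAB kAB).
by apply: hilb_value; case: acmY => -[].
Qed.
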